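(* Let $G$ be a finite group with conjugacy classes $c_1,\dots,c_k$ and irreducible characters $\gamma^1,\dots,\gamma^k$, and let $z_1,\dots,z_k\in\mathbb C\setminus\{0\}$. Let $\chi_{z_1,\dots,z_k}$ be the character of the generalized regular representation $T_{z_1,\dots,z_k}$. For $n=1,2,\dots$ $$\chi_{z_1,\dots,z_k}\big|_{G\sim S(n)}=\sum_{\Lambda\in\mathbb Y_n^{(k)}}M^{(n)}_{z_1,\dots,z_k}(\Lambda)\,\frac{\chi^{\Lambda}}{\mathrm{DIM}(\Lambda)},$$ where $M^{(n)}_{z_1,\dots,z_k}$ are probability measures on $\mathbb Y_n^{(k)}$, given by $$M^{(n)}_{z_1,\dots,z_k}(\lambda^{(1)},\dots,\lambda^{(k)})=\frac{n!}{(a_1\bar a_1+\dots+a_k\bar a_k)_n}\,\frac{(a_1\bar a_1)_{|\lambda^{(1)}|}}{|\lambda^{(1)}|!}\cdots\frac{(a_k\bar a_k)_{|\lambda^{(k)}|}}{|\lambda^{(k)}|!}\;M^{(|\lambda^{(1)}|)}_{a_1}(\lambda^{(1)})\cdots M^{(|\lambda^{(k)}|)}_{a_k}(\lambda^{(k)}),$$ with $$a_l=\sum_{i=1}^k\frac{z_i}{\zeta_{c_i}}\,\overline{\gamma^l(c_i)},\qquad l=1,\dots,k,\qquad \zeta_{c_i}=\frac{|G|}{|c_i|}.$$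
   Context: $G_n=G\sim S(n)$ is the wreath product: the set $G^n\times S(n)$ with multiplication $((g_1,\dots,g_n),s)((h_1,\dots,h_n),t)=((g_1h_{s^{-1}(1)},\dots,g_nh_{s^{-1}(n)}),st)$. $G_n$ is embedded in $G_{n+1}$ by $((g_1,\dots,g_n),s)\mapsto((g_1,\dots,g_n,e_G),s)$ with $s(n+1)=n+1$, and $G_\infty=\bigcup_n G_n$. For $x=((g_1,\dots,g_n),s)\in G_n$ and a cycle $i_1\to i_2\to\dots\to i_r\to i_1$ of $s$, the cycle-product is $g_{i_r}g_{i_{r-1}}\cdots g_{i_1}$; the cycle is of type $c_l$ if its cycle-product is in $c_l$; $[x]_{c_l}$ is the number of cycles of $s$ of type $c_l$. Canonical projection $p_{n,n+1}:G_{n+1}\to G_n$: let $\tilde x=((g_1,\dots,g_{n+1}),\tilde s)$. If $\tilde s(n+1)=n+1$, then $p_{n,n+1}(\tilde x)=((g_1,\dots,g_n),\tilde s|_{\{1,\dots,n\}})$. Otherwise, put $j=\tilde s(n+1)$; remove $n+1$ from its cycle in $\tilde s$ (so that $\tilde s^{-1}(n+1)$ is now mapped to $j$), delete $g_{n+1}$ from the list and replace $g_j$ by $g_jg_{n+1}$. $\mathfrak S_G=\varprojlim G_n$ is the projective limit with respect to the maps $p_{n,n+1}$, and $p_n:\mathfrak S_G\to G_n$ is the natural projection. $G_\infty\times G_\infty$ acts on $\mathfrak S_G$ on the right: for $W=(w_1,w_2)$, $xW=y$ with $y_n=w_2^{-1}x_nw_1$ for all $n$ large enough that $w_1,w_2\in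 G_n$. With $t_l=|z_l|^2$, the Ewens distribution on $G_n$ is $P^{\rm Ewens}_{t_1,\dots,t_k;n}(x)=\dfrac{t_1^{[x]_{c_1}}\cdots t_k^{[x]_{c_k}}}{|G|^n(t_1/\zeta_{c_1}+\dots+t_k/\zeta_{c_k})_n}$, $(a)_n=a(a+1)\cdots(a+n-1)$; these are consistent with the $p_{n,n+1}$, and $P^{\rm Ewens}_{t_1,\dots,t_k}=\varprojlim P^{\rm Ewens}_{t_1,\dots,t_k;n}$ is the resulting probability measure on $\mathfrak S_G$. The fundamental cocycles are $C_l(x,W)=[p_n(xW)]_{c_l}-[p_n(x)]_{c_l}$ for any $n$ with $W\in G_n\times G_n$ (independent of $n$). The generalized regular representation of $G_\infty\times G_\infty$ in $L^2(\mathfrak S_G,P^{\rm Ewens}_{t_1,\dots,t_k})$ is $(T_{z_1,\dots,z_k}(W)f)(x)=f(xW)z_1^{C_1(x,W)}\cdots z_k^{C_k(x,W)}$. Its character is the function on $G_\infty$ $$\chi_{z_1,\dots,z_k}(x)=\langle T_{z_1,\dots,z_k}(x,e)\zeta_0,\zeta_0\rangle_{L^2(\mathfrak S_G,P^{\rm Ewens}_{t_1,\dots,t_k})},$$ where $\zeta_0\equiv1$ and $e$ is the unit of $G_\infty$. $\mathbb Y_n^{(k)}$ is the set of $k$-tuples $\Lambda=(\lambda^{(1)},\dots,\lambda^{(k)})$ of Young diagrams with $|\lambda^{(1)}|+\dots+|\lambda^{(k)}|=n$. It parameterizes the irreducible representations of $G_n$; $\chi^\Lambda$ and $\mathrm{DIM}(\Lambda)$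 denote the character and dimension. The parameterization is the standard one (Macdonald, Appendix B of Chapter I): if $V_l$ has character $\gamma^l$ and $n_l=|\lambda^{(l)}|$, the representation labelled $\Lambda$ is induced from $\prod_l G\sim S(n_l)$ of the outer tensor product over $l$ of $V_l^{\otimes n_l}\otimes S^{\lambda^{(l)}}$, $S^\lambda$ being the irreducible $S(|\lambda|)$-module labelled by $\lambda$ (one-row $\lambda$ giving the trivial module). Equivalently, in the polynomial algebra in variables $p_r(c_i)$, with $p_r(\gamma^l)=\sum_i\zeta_{c_i}^{-1}\gamma^l(c_i)p_r(c_i)$ and $s_\lambda(\gamma^l)$ the Schur function in the power sums $p_r(\gamma^l)$, one has $\prod_l p_{\mu^{(l)}}(c_l)=\sum_{\Lambda}\overline{\chi^\Lambda_{(\mu^{(1)},\dots,\mu^{(k)})}}\prod_l s_{\lambda^{(l)}}(\gamma^l)$, where $\chi^\Lambda_{(\mu^{(1)},\dots,\mu^{(k)})}$ is the value at elements whose cycles of type $c_l$ have lengths the parts of $\mu^{(l)}$, for all $l$. For $z\in\mathbb C\setminus\{0\}$ the $z$-measure is $$M_z^{(n)}(\lambda)=\frac{n!}{(z\bar z)_n}\prod_{\Box\in\lambda}\frac{(z+c(\Box))(\bar z+c(\Box))}{h^2(\Box)},\qquad|\lambda|=n,$$ with $c(\Box)=j-i$ the content and $h(\Box)=\lambda_i-i+\lambda'_j-j+1$ the hook-length of the box in row $i$ and column $j$; $M^{(0)}_z(\emptyset)=1$. If $a_l=0$, the product $\frac{(a_l\bar a_l)_m}{m!}M^{(m)}_{a_l}(\lambda)$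 is read as $\prod_{\Box\in\lambda}(a_l+c(\Box))(\bar a_l+c(\Box))/h^2(\Box)$. *)

(* Defs.v *)
From HB Require Import structures.
From mathcomp Require Import all_boot all_order all_algebra all_fingroup.
From mathcomp Require Import all_solvable all_field all_character.
From mathcomp Require Import all_classical all_reals all_analysis.
From mathcomp Require Import complex.

Set Implicit Arguments.
Unset Strict Implicit.
Unset Printing Implicit Defensive.

Import Order.TTheory GRing.Theory Num.Theory GroupScope.
Local Open Scope ring_scope.
Local Open Scope complex_scope.

(* The group G is the whole of gT, and {1, .., n} is 'I_n, so that the point
   n + 1 of {1, .., n + 1} is ord_max : 'I_n.+1 and lift ord_max is the
   inclusion of {1, .., n} into {1, .., n + 1}. *)
Record wreath (gT : finGroupType) (n : nat) :=
  Wreath { wbase : {ffun 'I_n -> gT}; wperm : 'S_n }.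

Section WreathGroup.
Variables (gT : finGroupType) (n : nat).
Local Open Scope group_scope.
Implicit Types x y : wreath gT n.

Definition pair_of_wreath x := (wbase x, wperm x).
Definition wreath_of_pair (p : {ffun 'I_n -> gT} * 'S_n) := Wreath p.1 p.2.
Lemma pair_of_wreathK : cancel pair_of_wreath wreath_of_pair.
Proof. by case. Qed.

HB.instance Definition _ :=
  Finite.copy (wreath gT n) (can_type pair_of_wreathK).

(* In mathcomp t * s is "t, then s", i.e. the composite written st in the
   formula for the multiplication of the wreath product. *)
Definition wreath_mul x y : wreath gT n :=
  Wreath [ffun i => wbase x i * wbase y ((wperm x)^-1 i)] (wperm y * wperm x).
Definition wreath_one : wreath gT n := Wreath [ffun=> 1] 1.
Definition wreath_inv x : wreath gT n :=
  Wreath [ffun i => (wbase x (wperm x i))^-1] (wperm x)^-1.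

Lemma wreathP x y :
  (forall i, wbase x i = wbase y i) -> (forall i, wperm x i = wperm y i) ->
  x = y.
Proof.
by case: x y => [g s] [h t] /= /ffunP-> /permP->.
Qed.

Lemma wreath_mulA : associative wreath_mul.
Proof.
move=> x y z; apply: wreathP => i /=; last by rewrite !permM.
by rewrite !ffunE mulgA invMg permM.
Qed.
Lemma wreath_mul1 : left_id wreath_one wreath_mul.
Proof.
move=> x; apply: wreathP => i /=; last by rewrite mulg1.
by rewrite !ffunE invg1 perm1 mul1g.
Qed.
Lemma wreath_mulV : left_inverse wreath_one wreath_inv wreath_mul.
Proof.
move=> x; apply: wreathP => i /=; last by rewrite mulgV.
by rewrite !ffunE invgK mulVg.
Qed.

HB.instance Definition _ := Finite_isGroup.Build (wreath gT n)
  wreath_mulA wreath_mul1 wreath_mulV.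

Lemma wbaseM x y i : wbase (x * y) i = wbase x i * wbase y ((wperm x)^-1 i).
Proof. by rewrite /= ffunE. Qed.
Lemma wpermM x y i : wperm (x * y) i = wperm x (wperm y i).
Proof. by rewrite permM. Qed.

(* For the cycle i_1 = i -> i_2 -> .. -> i_r -> i_1 of the permutation of x,
   this is g_{i_r} ... g_{i_1}. *)
Definition cycle_product x (i : 'I_n) : gT :=
  \prod_(j <- rev (traject (wperm x) i #|porbit (wperm x) i|)) wbase x j.

(* The cycle-products read from the points of a cycle are conjugate. *)
Definition cycles_of_type (A : {set gT}) x : {set {set 'I_n}} :=
  [set C in porbits (wperm x) | [exists i in C, cycle_product x i \in A]]%SET.

Definition ncycles (A : {set gT}) x : nat := #|cycles_of_type A x|.

End WreathGroup.

Section Tower.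
Variable gT : finGroupType.
Local Open Scope group_scope.

Definition wembed n (x : wreath gT n) : wreath gT n.+1 :=
  Wreath [ffun i => if unlift ord_max i is Some j then wbase x j else 1]
         (lift_perm ord_max ord_max (wperm x)).

Definition wproj_fun n (s : 'S_n.+1) (i : 'I_n) : 'I_n :=
  odflt i (unlift ord_max
    (if s (lift ord_max i) == ord_max then s ord_max else s (lift ord_max i))).

Lemma lift_wproj_fun n (s : 'S_n.+1) (i : 'I_n) :
  lift ord_max (wproj_fun s i) =
  if s (lift ord_max i) == ord_max then s ord_max else s (lift ord_max i).
Proof.
rewrite /wproj_fun; case: unliftP => [j -> //|/=].
case: ifP => [/eqP e1 e2|/eqP e1 /e1 //].
have /perm_inj/eqP := etrans e1 (esym e2).
by rewrite eq_sym (negPf (neq_lift _ _)).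
Qed.

Lemma wproj_fun_inj n (s : 'S_n.+1) : injective (wproj_fun s).
Proof.
move=> i j /(congr1 (lift ord_max)); rewrite !lift_wproj_fun.
have lN k : (lift ord_max k == ord_max :> 'I_n.+1) = false.
  by rewrite eq_sym; apply/negbTE/neq_lift.
case: ifP => [/eqP ei|ni]; case: ifP => [/eqP ej|nj].
- by move=> _; apply/(@lift_inj _ ord_max)/(@perm_inj _ s); rewrite ei ej.
- by move/perm_inj/eqP; rewrite eq_sym lN.
- by move/perm_inj/eqP; rewrite lN.
- by move/perm_inj/lift_inj.
Qed.

Definition wproj n (x : wreath gT n.+1) : wreath gT n :=
  Wreath
    [ffun i => if wperm x ord_max == lift ord_max i
               then wbase x (lift ord_max i) * wbase x ord_max
               else wbase x (lift ord_max i)]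
    (perm (@wproj_fun_inj n (wperm x))).

Lemma lift_maxF n (i : 'I_n) : (lift ord_max i == ord_max) = false.
Proof. by rewrite eq_sym; apply/negbTE/neq_lift. Qed.

Lemma lift_wproj n (x : wreath gT n.+1) (i : 'I_n) :
  lift ord_max (wperm (wproj x) i) =
  if wperm x (lift ord_max i) == ord_max then wperm x ord_max
  else wperm x (lift ord_max i).
Proof. by rewrite permE lift_wproj_fun. Qed.

Lemma lift_wprojV n (x : wreath gT n.+1) (i : 'I_n) :
  lift ord_max ((wperm (wproj x))^-1 i) =
  if wperm x ord_max == lift ord_max i then (wperm x)^-1 ord_max
  else (wperm x)^-1 (lift ord_max i).
Proof.
have [j ->] : exists j, i = wperm (wproj x) j.
  by exists ((wperm (wproj x))^-1 i); rewrite permKV.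
rewrite permK !lift_wproj;
case: (wperm x (lift ord_max j) =P ord_max) => [e|ne].
  by rewrite eqxx; apply/(@perm_inj _ (wperm x)); rewrite permKV.
by rewrite permK (inj_eq perm_inj) eq_sym lift_maxF.
Qed.

Lemma wembed_inj n : injective (@wembed n).
Proof.
move=> x y [/ffunP eb /permP ep]; apply: wreathP => i.
  by have := eb (lift ord_max i); rewrite !ffunE liftK.
by have := ep (lift ord_max i); rewrite !lift_perm_lift => /lift_inj.
Qed.

Lemma wbase_embed n (x : wreath gT n) i :
  wbase (wembed x) (lift ord_max i) = wbase x i.
Proof. by rewrite ffunE liftK. Qed.

Lemma wbase_embed_max n (x : wreath gT n) : wbase (wembed x) ord_max = 1.
Proof. by rewrite ffunE unlift_none. Qed.

Lemma wperm_embed n (x : wreath gT n) i :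
  wperm (wembed x) (lift ord_max i) = lift ord_max (wperm x i).
Proof. exact: lift_perm_lift. Qed.

Lemma wperm_embed_max n (x : wreath gT n) : wperm (wembed x) ord_max = ord_max.
Proof. exact: lift_perm_id. Qed.

Lemma wpermV_embed n (x : wreath gT n) i :
  (wperm (wembed x))^-1 (lift ord_max i) = lift ord_max ((wperm x)^-1 i).
Proof. by rewrite (lift_permV ord_max ord_max) lift_perm_lift. Qed.

Lemma wembedM n : {morph @wembed n : x y / x * y}.
Proof.
move=> x y; apply: wreathP => i; last by rewrite /= (lift_permM _ ord_max).
rewrite [RHS]wbaseM; case: (unliftP ord_max i) => [j ->|->].
  by rewrite wpermV_embed !wbase_embed wbaseM.
by rewrite -[in RHS](wperm_embed_max x) permK !wperm_embed_max !wbase_embed_max mulg1.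
Qed.

Lemma wembedV n (x : wreath gT n) : wembed x^-1 = (wembed x)^-1.
Proof.
apply/(mulgI (wembed x)); rewrite mulgV -wembedM mulgV.
apply: wreathP => i; last by rewrite /= lift_perm1.
by rewrite !ffunE; case: unliftP => // j _; rewrite ffunE.
Qed.

Lemma wembedK n : cancel (@wembed n) (@wproj n).
Proof.
move=> x; apply: wreathP => i.
  by rewrite ffunE wperm_embed_max eq_sym lift_maxF wbase_embed.
by apply/(@lift_inj _ ord_max); rewrite lift_wproj wperm_embed lift_maxF.
Qed.

Lemma wprojMl n (u : wreath gT n) (x : wreath gT n.+1) :
  wproj (wembed u * x) = u * wproj x.
Proof.
apply: wreathP => i; last first.
  apply/(@lift_inj _ ord_max).
  rewrite lift_wproj !wpermM -wperm_embed lift_wproj.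
  rewrite -{2}(wperm_embed_max u) (inj_eq perm_inj).
  by case: ifP.
rewrite [RHS]wbaseM [LHS]ffunE [in RHS]ffunE !wbaseM wpermM wbase_embed.
have -> : (wperm (wembed u))^-1 ord_max = ord_max.
  by rewrite -[in LHS](wperm_embed_max u) permK.
have -> : (wperm (wembed u) (wperm x ord_max) == lift ord_max i) =
          (wperm x ord_max == lift ord_max ((wperm u)^-1 i)).
  by rewrite -wpermV_embed -[RHS](inj_eq (@perm_inj _ (wperm (wembed u)))) permKV.
by rewrite wpermV_embed wbase_embed_max mul1g; case: ifP; rewrite ?mulgA.
Qed.

Lemma wprojMr n (u : wreath gT n) (x : wreath gT n.+1) :
  wproj (x * wembed u) = wproj x * u.
Proof.
apply: wreathP => i; last first.
  apply/(@lift_inj _ ord_max).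
  by rewrite wpermM !lift_wproj !wpermM wperm_embed wperm_embed_max.
rewrite [RHS]wbaseM [LHS]ffunE [in RHS]ffunE !wbaseM wpermM wperm_embed_max.
rewrite -[wbase u _]wbase_embed lift_wprojV.
case: eqP => [<-|//].
by rewrite permK wbase_embed_max mulg1 mulgA.
Qed.

End Tower.

Section Ginf.
Variable gT : finGroupType.
Local Open Scope group_scope.

(* x as an element of the union of the G_n, seen as i |-> (g_i, s(i)), extended
   to all of nat by i |-> (e_G, i); wext_embed below says that this is
   compatible with the embedding of G_n into G_{n+1}. *)
Definition wext n (x : wreath gT n) : nat -> gT * nat :=
  fun i => if insub i is Some j then (wbase x j, val (wperm x j)) else (1, i).

Definition Ginf : Type := {w : nat -> gT * nat | exists n, range (@wext n) w}.

Definition Ginf_of n (x : wreath gT n) : Ginf :=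
  exist _ (wext x) (ex_intro _ n (imageP (@wext n) (I : setT x))).

Definition in_level (w : Ginf) n : Prop := range (@wext n) (sval w).

Definition Ginf_level (w : Ginf) : nat := projT1 (cid (proj2_sig w)).

(* w as an element of G_n when in_level w n *)
Definition at_level (w : Ginf) n : wreath gT n :=
  xget 1 [set x | wext x = sval w]%classic.

Definition Ginf1 : Ginf := Ginf_of (1 : wreath gT 0).

Lemma wext_inj n : injective (@wext n).
Proof.
move=> x y e; have ee (i : 'I_n) :
    (wbase x i, val (wperm x i)) = (wbase y i, val (wperm y i)).
  by have := congr1 (@^~ (val i)) e; rewrite /wext valK.
by apply: wreathP => i; have [? /val_inj] := ee i.
Qed.

Lemma wext_embed n (x : wreath gT n) : wext (wembed x) = wext x.
Proof.
apply/funext => i; rewrite /wext.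
case: insubP => [j _ vj|]; last first.
  rewrite -leqNgt => ni; case: insubP => // j; rewrite ltnNge.
  by rewrite (ltnW ni).
case: (unliftP ord_max j) vj => [k|] -> vj.
  have <- : val k = i by rewrite -vj; apply/esym/lift_max.
  by rewrite valK wbase_embed wperm_embed; congr (_, _); apply: lift_max.
have <- : n = i by rewrite -vj.
by rewrite wperm_embed_max wbase_embed_max insubF ?ltnn.
Qed.

Lemma at_levelE w n : in_level w n -> wext (at_level w n) = sval w.
Proof. by case=> x _ xw; rewrite /at_level; case: xgetP => // /(_ x) /(_ xw). Qed.

Lemma at_levelS w n : in_level w n ->
  in_level w n.+1 /\ at_level w n.+1 = wembed (at_level w n).
Proof.
move=> wn; have lS : in_level w n.+1.
  by exists (wembed (at_level w n)) => //; rewrite wext_embed at_levelE.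
by split=> //; apply: wext_inj; rewrite at_levelE // wext_embed at_levelE.
Qed.

Lemma Ginf_levelP w n : (Ginf_level w <= n)%N -> in_level w n.
Proof.
move=> /subnK <-; elim: (n - _)%N => [|d ihd]; first exact: (projT2 (cid _)).
by have [] := at_levelS ihd.
Qed.

Lemma at_level_of n (x : wreath gT n) : at_level (Ginf_of x) n = x.
Proof. by apply: wext_inj; rewrite at_levelE //; exists x. Qed.

End Ginf.

Record vperm (gT : finGroupType) := Vperm {
  vproj :> forall n, wreath gT n;
  vprojP : forall n, wproj (vproj n.+1) = vproj n }.

Section Vperm.
Variable gT : finGroupType.
Local Open Scope group_scope.

Fixpoint vone n : wreath gT n :=
  if n is n'.+1 then wembed (vone n') else 1.

HB.instance Definition _ := gen_eqMixin (vperm gT).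
HB.instance Definition _ := gen_choiceMixin (vperm gT).
HB.instance Definition _ :=
  isPointed.Build (vperm gT) (@Vperm gT vone (fun n => wembedK _)).

Definition cylinders : set (set (vperm gT)) :=
  [set C | exists n (A : set (wreath gT n)),
     C = (fun x : vperm gT => x n) @^-1` A]%classic.

Implicit Types (W : Ginf gT * Ginf gT) (x : vperm gT).

Definition pair_level W := maxn (Ginf_level W.1) (Ginf_level W.2).

Definition act_at W x n : wreath gT n :=
  (at_level W.2 n)^-1 * x n * at_level W.1 n.

Lemma act_atP W x n : (pair_level W <= n)%N ->
  wproj (act_at W x n.+1) = act_at W x n.
Proof.
rewrite geq_max => /andP[/Ginf_levelP l1 /Ginf_levelP l2]; rewrite /act_at.
have [_ ->] := at_levelS l1; have [_ ->] := at_levelS l2.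
by rewrite -wembedV wprojMr wprojMl vprojP.
Qed.

Definition wshift (u : forall n, wreath gT n) : forall n, wreath gT n :=
  fun n => wproj (u n.+1).

Lemma wshift_ge N l (u : forall n, wreath gT n) n :
  (forall m, (N <= m)%N -> wproj (u m.+1) = u m) -> (N <= n)%N ->
  iter l wshift u n = u n.
Proof.
move=> cu; elim: l n => [//|l ihl] n Nn.
by rewrite iterS /wshift ihl ?cu // (leq_trans Nn).
Qed.

Lemma wshift_coherent N (u : forall n, wreath gT n) :
  (forall m, (N <= m)%N -> wproj (u m.+1) = u m) ->
  forall n, wproj (iter N wshift u n.+1) = iter N wshift u n.
Proof.
elim: N u => [|N ihN] u cu n; first exact: cu.
rewrite iterSr; apply: ihN => m Nm.
by rewrite /wshift cu.
Qed.

(* act_at W x is coherent only from the level of W on, and each wshift fills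
   one lower level by projection. *)
Definition vact W x : vperm gT :=
  Vperm (wshift_coherent (@act_atP W x)).

Lemma vactE W x n : (pair_level W <= n)%N ->
  vact W x n = (at_level W.2 n)^-1 * x n * at_level W.1 n.
Proof. exact: (wshift_ge _ (@act_atP W x)). Qed.

End Vperm.

Notation vpermM gT := (g_sigma_algebraType (@cylinders gT)).

Definition pochhammer (F : pzRingType) (a : F) (n : nat) : F :=
  \prod_(i < n) (a + i%:R).

Definition zeta (F : fieldType) (gT : finGroupType) (A : {set gT}) : F :=
  #|[set: gT]|%:R / #|A|%:R.

Definition enum_classes (gT : finGroupType) k (c : 'I_k -> {set gT}) : Prop :=
  injective c /\ forall A, A \in classes [set: gT] <-> exists l, A = c l.

Definition ewens (R : realType) (gT : finGroupType) k (c : 'I_k -> {set gT})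
    (t : 'I_k -> R) n (x : wreath gT n) : R :=
  (\prod_l t l ^+ ncycles (c l) x) /
  (#|[set: gT]|%:R ^+ n * pochhammer (\sum_l t l / zeta R (c l)) n).

(* P is the projective limit of the Ewens distributions: its image under each
   p_n is the Ewens distribution on G_n. *)
Definition is_ewens (R : realType) (gT : finGroupType) k (c : 'I_k -> {set gT})
    (t : 'I_k -> R) (P : probability (vpermM gT) R) : Prop :=
  forall n (x : wreath gT n),
    P [set y : vperm gT | y n = x]%classic = (ewens c t x)%:E.

Section Representation.
Variables (R : realType) (gT : finGroupType) (k : nat).
Variables (c : 'I_k -> {set gT}) (z : 'I_k -> R[i]).
Implicit Types (W : Ginf gT * Ginf gT) (f g : vperm gT -> R[i]).

Definition cocycle l (x : vperm gT) W : int :=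
  (ncycles (c l) (vact W x (pair_level W)))%:Z
    - (ncycles (c l) (x (pair_level W)))%:Z.

Definition genreg W f : vperm gT -> R[i] :=
  fun x => f (vact W x) * \prod_l z l ^ cocycle l x W.

Definition cintegral (P : probability (vpermM gT) R) f : R[i] :=
  (Rintegral P setT (fun x => complex.Re (f x)) +i*
   Rintegral P setT (fun x => complex.Im (f x))).

Definition L2dot (P : probability (vpermM gT) R) f g : R[i] :=
  cintegral P (fun x => f x * (g x)^*%R).

Definition chi_z (P : probability (vpermM gT) R) (x : Ginf gT) : R[i] :=
  L2dot P (genreg (x, Ginf1 gT) (fun=> 1)) (fun=> 1).

End Representation.

(* A Young diagram is the sequence of its nonzero row lengths.  Rows and
   columns are numbered from 0, which does not change contents. *)
Definition is_young (lam : seq nat) : bool := sorted geq lam && (0 \notin lam)%N.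

Definition box_content (F : pzRingType) (i j : nat) : F := j%:R - i%:R.

Definition col_length (lam : seq nat) (j : nat) : nat :=
  count (fun r => j < r)%N lam.

(* The terms of lambda_i - i + lambda'_j - j + 1 are grouped so that, for a box
   of the diagram, no truncated subtraction occurs. *)
Definition hook (lam : seq nat) (i j : nat) : nat :=
  ((nth 0 lam i - j.+1) + (col_length lam j - i.+1) + 1)%N.

Section ZMeasure.
Variable R : realType.
Implicit Types (a : R[i]) (lam : seq nat).

Definition zprod a lam : R[i] :=
  \prod_(i < size lam) \prod_(j < nth 0%N lam i)
    ((a + box_content _ i j) * (a^*%R + box_content _ i j) / (hook lam i j)%:R ^+ 2).

Definition zmeasure a lam : R[i] :=
  (sumn lam)`!%:R / pochhammer (a * a^*%R) (sumn lam) * zprod a lam.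

(* (a \bar a)_m / m! * M_a^(m)(lam) *)
Definition zfactor a lam : R[i] :=
  if a == 0 then zprod a lam
  else pochhammer (a * a^*%R) (sumn lam) / (sumn lam)`!%:R * zmeasure a lam.

End ZMeasure.

(* Diagrams with at most n boxes have at most n rows, of length at most n. *)
Definition rows_of n (s : n.-bseq 'I_n.+1) : seq nat := [seq val i | i <- s].

Definition is_multi k n (L : {ffun 'I_k -> n.-bseq 'I_n.+1}) : bool :=
  [forall l, is_young (rows_of (L l))]
  && (\sum_l sumn (rows_of (L l)) == n)%N.

Definition multiyoung k n : finType :=
  {L : {ffun 'I_k -> n.-bseq 'I_n.+1} | is_multi L}.

Definition diagram k n (L : multiyoung k n) (l : 'I_k) : seq nat :=
  rows_of (val L l).

Section Schur.
Variables (F : fieldType) (p : nat -> F).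

(* [:: h_0; ..; h_n] as polynomials in the power sums, from Newton's identities
   n h_n = p_1 h_{n-1} + .. + p_n h_0 *)
Fixpoint hseq (n : nat) : seq F :=
  if n is m.+1 then
    rcons (hseq m) (m.+1%:R^-1 * \sum_(r < m.+1) p r.+1 * (hseq m)`_(m - r))
  else [:: 1].

Definition complete_sym (n : nat) : F := (hseq n)`_n.

(* The Schur function in the power sums p, by the Jacobi-Trudi formula *)
Definition schur (lam : seq nat) : F :=
  \det (\matrix_(i < size lam, j < size lam)
    if (i <= nth 0 lam i + j)%N then complete_sym (nth 0 lam i + j - i)%N
    else 0).

End Schur.

Section Characters.
Variables (R : realType) (gT : finGroupType).

Definition is_irr_char (phi : gT -> R[i]) : Prop :=
  exists d (rho : mx_representation R[i] [set: gT] d),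
    mx_irreducible rho /\ forall g, phi g = \tr (rho g).

Definition enum_irr k (gamma : 'I_k -> gT -> R[i]) : Prop :=
  injective gamma /\ forall phi, is_irr_char phi <-> exists l, phi = gamma l.

Variables (k : nat) (c : 'I_k -> {set gT}) (gamma : 'I_k -> gT -> R[i]).

Definition class_value (phi : gT -> R[i]) (A : {set gT}) : R[i] :=
  phi (fingroup.repr A).

(* p_r(gamma^l), for values p r i of the variables p_r(c_i) *)
Definition psum_irr (p : nat -> 'I_k -> R[i]) (l : 'I_k) (r : nat) : R[i] :=
  \sum_i (zeta R[i] (c i))^-1 * class_value (gamma l) (c i) * p r i.

(* rho L is the irreducible representation labelled by L.  The labelling is
   pinned down by the last clause, the expansion of the power sum products in
   the Schur functions; an identity in the polynomial algebra generated by the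
   p_r(c_i), it is stated for all complex values of these variables, and at
   each x instead of at each cycle type. *)
Definition std_labelling n (d : multiyoung k n -> nat)
    (rho : forall L, mx_representation R[i] [set: wreath gT n] (d L)) : Prop :=
  [/\ forall L, mx_irreducible (rho L),
      forall L L', mx_rsim (rho L) (rho L') -> L = L',
      forall m (sigma : mx_representation R[i] [set: wreath gT n] m),
        mx_irreducible sigma -> exists L, mx_rsim sigma (rho L)
    & forall (p : nat -> 'I_k -> R[i]) (x : wreath gT n),
        \prod_l \prod_(C in cycles_of_type (c l) x) p #|C| l =
        \sum_L (\tr (rho L x))^*%R
               * \prod_l schur (psum_irr p l) (diagram L l)].

Definition aparam (z : 'I_k -> R[i]) (l : 'I_k) : R[i] :=
  \sum_i z i / zeta R[i] (c i) * (class_value (gamma l) (c i))^*%R.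

Definition multi_zmeasure (z : 'I_k -> R[i]) n (L : multiyoung k n) : R[i] :=
  n`!%:R / pochhammer (\sum_l aparam z l * (aparam z l)^*%R) n
  * \prod_l zfactor (aparam z l) (diagram L l).

End Characters.

(* Main.v *)
Require Import Defs.
From HB Require Import structures.
From mathcomp Require Import all_boot all_order all_algebra all_fingroup.
From mathcomp Require Import all_solvable all_field all_character.
From mathcomp Require Import all_classical all_reals all_analysis.
From mathcomp Require Import complex.
From mathcomp Require Import zify ring.

Set Implicit Arguments.
Unset Strict Implicit.
Unset Printing Implicit Defensive.

Import Order.TTheory GRing.Theory Num.Theory GroupScope.
Local Open Scope ring_scope.
Local Open Scope complex_scope.

(* The cocycles can be read at level n, so the character is a finite sum:
   chi_z(x) = (|G|^n (t)_n)^-1 sum_y phi(y x) conj(phi(y)) with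
   phi(y) = prod_l z_l^[y]_(c_l).  Specializing all p_r(c_i) to the complex
   conjugate of z_i in the expansion of the power sum products and conjugating
   gives phi = sum_L chi^L prod_l s_(L_l)(p_r = a_l).  By the orthogonality of
   matrix coefficients the convolution is then
   |G_n| sum_L |prod_l s_(L_l)(a_l)|^2 chi^L / DIM(L).  Finally
   s_lambda(p_r = a) = prod (a + content) / hook, from the Jacobi-Trudi
   determinant with h_m = (a)_m / m!, and sum_l |a_l|^2 = sum_i t_i / zeta_i by
   the second orthogonality relation of G.  The masses sum to one because
   chi_z(1) = 1. *)

(** * Schur functions at constant power sums *)

Lemma pochhammerS (F : pzRingType) (a : F) n :
  pochhammer a n.+1 = pochhammer a n * (a + n%:R).
Proof. exact: big_ord_recr. Qed.

Lemma pochhammerD (F : pzRingType) (a : F) m n :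
  pochhammer a (m + n) = pochhammer a m * pochhammer (a + m%:R) n.
Proof.
rewrite /pochhammer big_split_ord /=; congr (_ * _).
by apply: eq_bigr => i _; rewrite natrD addrA.
Qed.

Lemma pochhammer1 (F : pzRingType) (a : F) : pochhammer a 1 = a.
Proof. by rewrite /pochhammer big_ord1 addr0. Qed.

Lemma pochhammerSl (F : pzRingType) (a : F) n :
  pochhammer a n.+1 = a * pochhammer (a + 1) n.
Proof. by rewrite -add1n pochhammerD pochhammer1. Qed.

Section CompleteSym.
Variable F : fieldType.
Implicit Types (p : nat -> F) (a : F).

Lemma size_hseq p n : size (hseq p n) = n.+1.
Proof. by elim: n => //= n IHn; rewrite size_rcons IHn. Qed.

Lemma nth_hseq p m n : (m <= n)%N -> (hseq p n)`_m = complete_sym p m.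
Proof.
elim: n => [|n IHn]; first by case: m.
rewrite leq_eqVlt => /predU1P[-> //|lt_mn].
by rewrite /= nth_rcons size_hseq lt_mn IHn.
Qed.

Lemma complete_symS p n :
  complete_sym p n.+1 =
  n.+1%:R^-1 * \sum_(r < n.+1) p r.+1 * complete_sym p (n - r).
Proof.
rewrite /complete_sym /= nth_rcons size_hseq ltnn eqxx; congr (_ * _).
by apply: eq_bigr => r _; rewrite nth_hseq // leq_subr.
Qed.

(** Newton's identities for [n.+1] and [n] differ by the single term [a * complete_sym (fun=> a) n],
    which leaves the two-term recursion satisfied by [(a)_n / n!]. *)
Lemma complete_sym_cst a n (F0 : forall m, m.+1%:R != 0 :> F) :
  complete_sym (fun=> a) n = n`!%:R^-1 * pochhammer a n.
Proof.
have S1 m : m.+1%:R * complete_sym (fun=> a) m.+1 =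
            a * \sum_(r < m.+1) complete_sym (fun=> a) r.
  rewrite complete_symS mulrA divff // mul1r mulr_sumr.
  rewrite (reindex_inj rev_ord_inj) /=; apply: eq_bigr => r _.
  by rewrite subSS subKn // -ltnS.
elim: n => [|n IHn]; first by rewrite /pochhammer big_ord0 invr1 mulr1.
have : n.+1%:R * complete_sym (fun=> a) n.+1 =
             (a + n%:R) * complete_sym (fun=> a) n.
  rewrite S1 big_ord_recr mulrDr mulrDl [LHS]addrC; congr (_ + _).
  by case: (n) => [|m]; rewrite ?S1 // big_ord0 mulr0 mul0r.
move/(congr1 ( *%R n.+1%:R^-1)); rewrite mulKf // => ->.
by rewrite IHn pochhammerS factS natrM invfM; ring.
Qed.

End CompleteSym.

(** * Jacobi-Trudi determinants with a polynomial parameter *)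

Section PolyDet.
Variable F : fieldType.
Hypothesis F0 : forall m, m.+1%:R != 0 :> F.
Implicit Types (a : {poly F}).

Definition hpoly a m : {poly F} := (m`!%:R^-1 : F) *: pochhammer a m.

(** Pascal's rule: [hpoly a m] is the binomial coefficient of [a + m - 1] over [m]. *)
Lemma hpolyS a m : hpoly a m.+1 = hpoly a m + hpoly (a - 1) m.+1.
Proof.
apply/(@scalerI _ _ m.+1`!%:R); first by case: m.+1`! (fact_gt0 m.+1).
have fN j : j`!%:R != 0 :> F by case: j`! (fact_gt0 j).
rewrite scalerDr /hpoly !scalerA !divff // !scale1r factS natrM mulfK //.
rewrite pochhammerS pochhammerSl subrK scaler_nat.
by rewrite -mulr_natr; ring.
Qed.

(* [hpoly a (p + j - i)], read as 0 when the index is negative. *)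
Definition hpolyZ a p i j : {poly F} :=
  if (i <= p + j)%N then hpoly a (p + j - i) else 0.

Lemma hpolyZS a p i j :
  hpolyZ a p i j.+1 = hpolyZ a p i j + hpolyZ (a - 1) p i j.+1.
Proof.
rewrite /hpolyZ addnS; case: (ltngtP i (p + j).+1) => [lt_i|lt_i|->].
- by rewrite -ltnS lt_i subSn // hpolyS.
- by rewrite leqNgt (ltn_trans _ lt_i) // addr0.
- by rewrite ltnn subnn add0r /hpoly /pochhammer !big_ord0.
Qed.

(** Induction on [j] with [p] free: the second summand of [hpolyZS] trades [j.+1] at [p] for [j] at
    [p.+1], and Pascal's rule for ['C(j, k)] recombines the two sums. *)
Lemma hpolyZ_binomial a p i j :
  hpolyZ a p i j = \sum_(k < j.+1) hpolyZ (a - k%:R) p i k * 'C(j, k)%:R.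
Proof.
elim: j a p => [|j IHj] a p; first by rewrite big_ord1 bin0 mulr1 subr0.
have eqS b q l : hpolyZ b q i l.+1 = hpolyZ b q.+1 i l.
  by rewrite /hpolyZ addSnnS.
rewrite hpolyZS eqS (IHj a) (IHj _ p.+1) [RHS]big_ord_recl.
rewrite [X in X + _]big_ord_recl subr0 !bin0 -addrA; congr (_ + _).
under [in RHS]eq_bigr => k _ do rewrite lift0 binS natrD mulrDr.
rewrite big_split /=; congr (_ + _).
  rewrite [RHS]big_ord_recr /= bin_small // mulr0 addr0.
  by [].
apply: eq_bigr => k _; rewrite -eqS; congr (hpolyZ _ _ _ _ * _).
by rewrite -addrA -opprD nat1r.
Qed.

(* Iterating [hpolyZS], column operations replace [a] by [a - j] in column [j]. *)
Lemma det_hpolyZ_shift r a (lam : nat -> nat) :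
  \det (\matrix_(i < r, j < r) hpolyZ a (lam i) i j) =
  \det (\matrix_(i < r, j < r) hpolyZ (a - j%:R) (lam i) i j).
Proof.
set N := (X in _ = \det X).
pose U : 'M[{poly F}]_r := \matrix_(k < r, j < r) 'C(j, k)%:R.
have -> : \matrix_(i < r, j < r) hpolyZ a (lam i) i j = N *m U.
  apply/matrixP=> i j; rewrite !mxE hpolyZ_binomial.
  rewrite (big_ord_widen r (fun k => hpolyZ (a - k%:R) (lam i) i k * 'C(j, k)%:R)) //.
  rewrite big_mkcond; apply: eq_bigr => k _; rewrite !mxE.
  by case: ltnP => // lt_jk; rewrite bin_small // mulr0.
rewrite det_mulmx [\det U](_ : _ = 1) ?mulr1 // -det_tr det_trig.
  by apply: big1 => i _; rewrite !mxE binn.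
by apply/is_trig_mxP => i j lt_ij; rewrite !mxE bin_small.
Qed.

(** Each Pochhammer symbol runs over consecutive shifts of [a]. On both sides one run starts at
    [a - i] and one at [a - j]; only their endpoints are exchanged. Up to the inverse factorial, the
    entry thus splits into a row factor and a column factor. *)
Lemma hpolyZ_factor a p i j :
  pochhammer (a - i%:R) i * hpolyZ (a - j%:R) p i j =
  pochhammer (a - i%:R) p * pochhammer (a - j%:R) j *
    (if (i <= p + j)%N then (p + j - i)`!%:R^-1 else 0 : F)%:P.
Proof.
rewrite /hpolyZ; case: leqP => [le_i|_]; last by rewrite !mulr0.
rewrite /hpoly -mul_polyC mulrCA [RHS]mulrC; congr (_ * _).
have shift u d : (a - (u + d)%:R) + d%:R = a - u%:R.
  by rewrite natrD opprD addrA subrK.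
case: (leqP i j) le_i => [/subnKC<-|/ltnW/subnKC<-] le_i.
  set d := (j - i)%N; have -> : (p + (i + d) - i = d + p)%N by lia.
  have -> : pochhammer (a - (i + d)%:R) (i + d) =
          pochhammer (a - (i + d)%:R) d * pochhammer (a - i%:R) i.
    by rewrite addnC pochhammerD addnC shift.
  by rewrite pochhammerD shift; ring.
set d := (i - j)%N.
have ep : p = (d + (p + j - (j + d)))%N by lia.
rewrite [in RHS]ep; move: (p + j - _)%N => q.
rewrite (pochhammerD _ d q) shift.
have -> : pochhammer (a - (j + d)%:R) (j + d) =
          pochhammer (a - (j + d)%:R) d * pochhammer (a - j%:R) j.
  by rewrite addnC pochhammerD addnC shift.
by ring.
Qed.

Lemma pochhammer_subX_neq0 i : pochhammer ('X - i%:R) i != 0 :> {poly F}.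
Proof.
apply/prodf_neq0 => j _.
rewrite -addrA addrC -[i%:R](@polyC_natr F) -[j%:R](@polyC_natr F) -polyCN -polyCD addrC.
by rewrite -size_poly_eq0 size_XaddC.
Qed.

(* The factors [pochhammer ('X - i%:R) i] cancelled here vanish at [1, .., i]:
   this is why the parameter is kept indeterminate. *)
Lemma det_hpolyZ r (lam : nat -> nat) :
  \det (\matrix_(i < r, j < r) hpolyZ 'X (lam i) i j) =
  (\prod_(i < r) pochhammer ('X - i%:R) (lam i)) *
  (\det (\matrix_(i < r, j < r)
     if (i <= lam i + j)%N then (lam i + j - i)`!%:R^-1 else 0 : F))%:P.
Proof.
rewrite det_hpolyZ_shift; set N := \matrix_(i, j) _; set E := \matrix_(i, j) _.
pose D : 'rV[{poly F}]_r := \row_i pochhammer ('X - i%:R) i.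
pose A : 'rV[{poly F}]_r := \row_i pochhammer ('X - i%:R) (lam i).
have /(congr1 determinant) : diag_mx D *m N = diag_mx A *m map_mx polyC E *m diag_mx D.
  apply/matrixP => i j; rewrite mul_diag_mx mul_mx_diag mul_diag_mx !mxE.
  by rewrite hpolyZ_factor mulrAC.
rewrite !det_mulmx [RHS]mulrC => /mulfI->; last first.
  by rewrite det_diag; apply/prodf_neq0 => i _; rewrite mxE pochhammer_subX_neq0.
rewrite det_diag det_map_mx; congr (_ * _).
by apply: eq_bigr => i _; rewrite mxE.
Qed.

End PolyDet.

(** Falling factorials are the values of monic polynomials [f j] of degree [j], so a unitriangular
    change of basis leads to the Vandermonde matrix. *)
Lemma det_ffact (F : comNzRingType) r (x : 'I_r -> nat) :
  \det (\matrix_(i < r, j < r) (x i ^_ j)%:R) =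
  \prod_(i < r) \prod_(j < r | (i < j)%N) ((x j)%:R - (x i)%:R) :> F.
Proof.
pose f j : {poly F} := \prod_(q < j) ('X - (q%:R)%:P).
have f_monic j : f j \is monic by apply: monic_prod => q _; apply: monicXsubC.
have size_f j : size (f j) = j.+1.
  rewrite /f -(big_mkord xpredT (fun q => 'X - (q%:R)%:P)).
  by rewrite size_prod_XsubC size_iota subn0.
have fE j m : (f j).[m%:R] = (m ^_ j)%:R.
  elim: j => [|j IHj]; first by rewrite /f big_ord0 hornerC.
  rewrite /f big_ord_recr hornerM -/(f j) IHj hornerXsubC ffactnSr.
  case: (leqP j m) => [le_jm|lt_mj]; first by rewrite natrM natrB.
  by rewrite !ffact_small // mul0r.
pose C : 'M[F]_r := \matrix_(j, q) (f j)`_q.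
pose X : 'rV[F]_r := \row_i (x i)%:R.
have -> : \matrix_(i < r, j < r) (x i ^_ j)%:R = (C *m Vandermonde r X)^T.
  apply/matrixP => i j; rewrite !mxE -fE (@horner_coef_wide _ r) ?size_f //.
  by apply: eq_bigr => q _; rewrite !mxE.
rewrite det_tr det_mulmx det_Vandermonde det_trig; last first.
  by apply/is_trig_mxP => i j lt_ij; rewrite mxE nth_default // size_f.
rewrite big1 ?mul1r => [|i _]; last first.
  by rewrite mxE; have /monicP := f_monic i; rewrite /lead_coef size_f.
by apply: eq_bigr => i _; apply: eq_bigr => j _; rewrite !mxE.
Qed.

Lemma det_rev (F : comNzRingType) r (A : 'M[F]_r) :
  \det (\matrix_(i, j) A (rev_ord i) (rev_ord j)) = \det A.
Proof.
pose s := perm (@rev_ord_inj r).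
have -> : \matrix_(i, j) A (rev_ord i) (rev_ord j) = row_perm s (col_perm s A).
  by apply/matrixP => i j; rewrite !mxE !permE.
rewrite row_permE col_permE !det_mulmx !det_perm odd_permV.
by rewrite mulrCA -signr_addb addbb mulr1.
Qed.

(* Strictly decreasing in [i]: the first-column hook-lengths of [lam]. *)
Definition beta (lam : seq nat) i := (nth 0 lam i + (size lam - i.+1))%N.

(** Scaling row [i] by the factorial of [beta lam i] turns the entry into the falling factorial
    [beta lam i ^_ (size lam - j.+1)]. Reversing rows and columns together makes the exponents
    increase, so that [det_ffact] applies. *)
Lemma det_inv_fact (F : fieldType) (lam : seq nat)
    (F0 : forall m, m.+1%:R != 0 :> F) :
  \det (\matrix_(i < size lam, j < size lam)
     if (i <= nth 0%N lam i + j)%N then (nth 0%N lam i + j - i)`!%:R^-1 else 0)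
  = (\prod_(i < size lam) (beta lam i)`!%:R^-1) *
    \prod_(i < size lam) \prod_(j < size lam | (i < j)%N)
      ((beta lam i)%:R - (beta lam j)%:R) :> F.
Proof.
set r := size lam.
have FN m : (0 < m)%N -> m%:R != 0 :> F by case: m.
pose D : 'rV[F]_r := \row_i (beta lam i)`!%:R^-1.
pose B : 'M[F]_r := \matrix_(i, j) (beta lam (rev_ord i) ^_ j)%:R.
rewrite [LHS](_ : _ = \det (diag_mx D *m \matrix_(i, j) B (rev_ord i) (rev_ord j))).
  rewrite det_mulmx det_rev det_diag det_ffact; congr (_ * _).
    by apply: eq_bigr => i _; rewrite mxE.
  rewrite (exchange_big_dep predT) // (reindex_inj rev_ord_inj).
  apply: eq_bigr => i _; rewrite (reindex_inj rev_ord_inj).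
  apply: eq_big => [j|j _]; last by rewrite !rev_ordK.
  by rewrite /=; have := ltn_ord i; have := ltn_ord j; lia.
congr (\det _); apply/matrixP => i j; rewrite mul_diag_mx !mxE rev_ordK /=.
rewrite /beta -/r; have := ltn_ord i; have := ltn_ord j.
move: (nth _ _ _) => p; move: (nat_of_ord i) (nat_of_ord j) => {}i {}j lt_j lt_i.
(* A negative index corresponds to a falling factorial whose exponent exceeds its base, so both
   sides are 0. *)
case: leqP => [le_i|lt_p]; last by rewrite ffact_small ?mulr0 //; lia.
have le_n : (r - j.+1 <= p + (r - i.+1))%N by lia.
have := ffact_fact le_n; have -> : (p + (r - i.+1) - (r - j.+1) = p + j - i)%N by lia.
by move=> <-; rewrite natrM invfM mulrAC mulVf ?mul1r // FN // ffact_gt0.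
Qed.

(* Deleting an empty last row or, when there is none, the first column lowers
   [beta lam i] by one; these two moves exhaust the diagram. *)
Lemma prod_hook_row lam i : sorted geq lam -> (i < size lam)%N ->
  ((\prod_(j < nth 0 lam i) hook lam i j) *
   \prod_(i.+1 <= k < size lam) (beta lam i - beta lam k) = (beta lam i)`!)%N.
Proof.
move: {2}(beta lam i) (erefl (beta lam i)) => n.
elim: n lam i => [|n IHn] lam i en slam lt_i.
  have [e1 e2] : nth 0%N lam i = 0%N /\ (size lam <= i.+1)%N.
    by move: en; rewrite /beta; lia.
  by rewrite en e1 big_ord0 big_geq.
case/lastP: lam slam lt_i en => [//|lam x] slam; rewrite size_rcons => lt_i en.
case: (posnP x) => [x0|x_gt0].
  rewrite x0 in en slam *.
  have lt_i' : (i < size lam)%N.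
    rewrite ltn_neqAle -ltnS lt_i andbT; apply/eqP => ei.
    by move: en; rewrite /beta nth_rcons ei ltnn eqxx size_rcons subnn.
  have bE k : (k < size lam)%N -> beta (rcons lam 0%N) k = (beta lam k).+1.
    by rewrite /beta nth_rcons size_rcons => lt_k; rewrite lt_k; lia.
  have b0 : beta (rcons lam 0%N) (size lam) = 0%N.
    by rewrite /beta nth_rcons ltnn eqxx size_rcons subnn.
  (* By [b0], the difference contributed by the empty last row is [beta lam i] of the full diagram,
     the leading factor of the factorial. *)
  have slam' : sorted geq lam.
    by move: slam; rewrite -cats1; case: (lam) => //= a l; rewrite cat_path => /andP[].
  move: (en); rewrite bE // => -[en'].
  rewrite big_nat_recr ?size_rcons //= b0 subn0 factS mulnA mulnC.
  congr (_ * _)%N; rewrite -IHn //; congr (_ * _)%N.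
    rewrite nth_rcons lt_i' /=; apply: eq_bigr => j _.
    by rewrite /hook nth_rcons lt_i' /col_length -cats1 count_cat /= !addn0.
  by apply: eq_big_nat => k /andP[_ lt_k]; rewrite bE // subSS.
set lam1 := rcons lam x in slam en *.
have sz1 : size lam1 = (size lam).+1 by rewrite size_rcons.
rewrite -sz1 in lt_i *.
pose lam2 := [seq y.-1 | y <- lam1].
have sz2 : size lam2 = size lam1 by rewrite size_map.
have pos : all (fun y => 0 < y)%N lam1.
  apply/(all_nthP 0%N) => k lt_k; apply: leq_trans x_gt0 _.
  have -> : x = nth 0%N lam1 (size lam) by rewrite /lam1 nth_rcons ltnn eqxx.
  have geq_trans : transitive geq by move=> a b e /= h1 h2; apply: leq_trans h2 h1.
  apply: (sorted_leq_nth geq_trans _ 0%N slam) => //; rewrite ?inE ?sz1 //.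
    by move=> y; apply: leqnn.
  by rewrite -ltnS -sz1.
have nE k : (k < size lam1)%N -> nth 0%N lam1 k = (nth 0%N lam2 k).+1.
  move=> lt_k; rewrite (nth_map 0%N) // prednK //.
  exact: (all_nthP 0%N pos).
have bE k : (k < size lam1)%N -> beta lam1 k = (beta lam2 k).+1.
  by move=> lt_k; rewrite /beta nE // sz2.
have hE j : hook lam1 i j.+1 = hook lam2 i j.
  rewrite /hook nE // subSS; congr (_ + (_ - _) + _)%N.
  rewrite /col_length count_map; apply: eq_count => y /=.
  by case: y.
(* No row is empty, so the leg of the first box of row [i] meets every row below. Its hook is
   therefore [beta lam1 i], the leading factor of the factorial. *)
have h0 : hook lam1 i 0 = (beta lam2 i).+1.
  rewrite /hook nE // subSS subn0 /col_length.
  have -> : count (fun y => 0 < y)%N lam1 = size lam1 by apply/eqP; rewrite -all_count.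
  by rewrite /beta sz2 addn1.
move: (en); rewrite bE // => -[en'].
rewrite nE // big_ord_recl h0 factS -mulnA; congr (_ * _)%N.
rewrite (eq_bigr (fun j : 'I__ => hook lam2 i j)); last first.
  by move=> j _; rewrite lift0 hE.
rewrite -IHn ?sz2 //; last first.
  rewrite sorted_map; apply: sub_sorted slam => a b /=; lia.
congr (_ * _)%N; apply: eq_big_nat => k /andP[_ lt_k].
by rewrite (bE k) // subSS.
Qed.

(** Evaluating [det_hpolyZ] at [a] gives the Jacobi-Trudi determinant. Row by row, the Pochhammer
    symbol yields the contents, and [prod_hook_row] turns factorials and differences of [beta] into
    hooks. *)
Lemma schur_cst (F : fieldType) (a : F) (lam : seq nat)
    (F0 : forall m, m.+1%:R != 0 :> F) (slam : sorted geq lam) :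
  schur (fun=> a) lam =
  \prod_(i < size lam) \prod_(j < nth 0%N lam i)
    ((a + box_content _ i j) / (hook lam i j)%:R).
Proof.
have fN m : m`!%:R != 0 :> F by case: m`! (fact_gt0 m).
have := congr1 (horner_eval a) (det_hpolyZ F0 (size lam) (nth 0%N lam)).
rewrite -det_map_mx rmorphM /= rmorph_prod /= /horner_eval hornerC det_inv_fact //.
have pE b m : (pochhammer ('X - b%:R) m).[a] = pochhammer (a - b%:R) m.
  rewrite horner_prod; apply: eq_bigr => j _.
  by rewrite !hornerE -!polyC_natr !hornerC.
rewrite (_ : map_mx _ _ = \matrix_(i < size lam, j < size lam)
    if (i <= nth 0 lam i + j)%N then complete_sym (fun=> a) (nth 0 lam i + j - i)%N
    else 0); last first.
  apply/matrixP => i j; rewrite !mxE /hpolyZ; case: ifP => _; last exact: horner0.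
  rewrite complete_sym_cst // /hpoly /horner_eval hornerZ; congr (_ * _).
  rewrite -[a in RHS]subr0 -(pE 0%N); congr (pochhammer _ _).[_].
  by rewrite subr0.
rewrite -/(schur (fun=> a) lam) => ->; rewrite -!big_split /=.
apply: eq_bigr => i _; rewrite pE.
rewrite [RHS]big_split /= /pochhammer; congr (_ * _).
  by apply: eq_bigr => j _; rewrite /box_content -addrA [- _ + _]addrC.
rewrite -(prod_hook_row slam (ltn_ord i)) natrM natr_prod invfM -prodfV.
have lt_beta k : (i < k < size lam)%N -> (beta lam k < beta lam i)%N.
  case/andP=> lt_ik lt_k; rewrite /beta.
  have : (nth 0 lam k <= nth 0 lam i)%N.
    have geq_trans : transitive geq by move=> y x z /= h1 h2; apply: leq_trans h2 h1.
    apply: (sorted_leq_nth geq_trans _ 0%N slam); rewrite ?inE //; last exact: ltnW.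
    by move=> y; apply: leqnn.
  by lia.
have -> : \prod_(j < size lam | (i < j)%N) ((beta lam i)%:R - (beta lam j)%:R) =
          \prod_(i.+1 <= k < size lam) (beta lam i - beta lam k)%:R :> F.
  rewrite big_geq_mkord; apply: eq_bigr => k lt_ik.
  by rewrite natrB // ltnW // lt_beta // lt_ik ltn_ord.
rewrite -mulrA -big_split /= big_nat_cond [X in _ * X]big1 ?mulr1.
  by rewrite natr_prod prodfV.
move=> k; rewrite andbT => /lt_beta; rewrite -subn_gt0.
by case: (_ - _)%N => // m _; rewrite mulVf.
Qed.

(** * Orthogonality of characters over a closed field *)

Lemma mxtrace_delta (R : pzSemiRingType) n (i j : 'I_n) :
  \tr (delta_mx i j : 'M[R]_n) = (i == j)%:R.
Proof.
rewrite /mxtrace (bigD1 i) //= mxE eqxx big1 ?addr0 // => l nli.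
by rewrite mxE (negPf nli).
Qed.

Section SchurOrthogonality.
Variables (C : numClosedFieldType) (gT : finGroupType) (G : {group gT}).
Local Notation reprG := (mx_representation C G).

Lemma irr_dim_gt0 n (rG : reprG n) : mx_irreducible rG -> (0 < n)%N.
Proof. by case: n rG => // rG [_ /eqP[]]; apply/matrixP => -[]. Qed.

(** Schur's lemma: the kernel and the image of [T] are submodules, so a nonzero [T] would be a
    similarity. *)
Lemma irr_hom0 n1 n2 (rG1 : reprG n1) (rG2 : reprG n2) (T : 'M[C]_(n1, n2)) :
    mx_irreducible rG1 -> mx_irreducible rG2 -> ~ mx_rsim rG1 rG2 ->
    {in G, forall x, rG1 x *m T = T *m rG2 x} ->
  T = 0.
Proof.
move=> [_ _ irr1] [_ _ irr2] nsim homT; apply/eqP; apply: contra_notT nsim => nzT.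
have kerT : kermx T = 0.
  apply/eqP; apply: contraNT nzT => nz_ker; rewrite -[T]mul1mx.
  apply/eqP/sub_kermxP/irr1 => //; last exact: submx1.
  apply/mxmoduleP => x Gx; apply/sub_kermxP.
  by rewrite -mulmxA homT // mulmxA mulmx_ker mul0mx.
have freeT : row_free T by rewrite -kermx_eq0 kerT.
have fullT : row_full T.
  rewrite -sub1mx -(genmxE T) irr2 ?submx1 // -?submx0 ?genmxE ?submx0 //.
  rewrite (eqmx_module _ (genmxE T)).
  by apply/mxmoduleP => x Gx; rewrite -homT // submxMl.
by exists T => //; rewrite -(eqP fullT) (eqP freeT).
Qed.

(** The unnormalized group average, which turns an arbitrary matrix into an intertwiner. *)
Definition avg_hom n1 n2 (rG1 : reprG n1) (rG2 : reprG n2) (A : 'M[C]_(n1, n2)) :=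
  \sum_(g in G) rG1 g *m A *m rG2 g^-1%g.

Lemma avg_homP n1 n2 (rG1 : reprG n1) (rG2 : reprG n2) A :
  {in G, forall x, rG1 x *m avg_hom rG1 rG2 A = avg_hom rG1 rG2 A *m rG2 x}.
Proof.
move=> x Gx; rewrite mulmx_sumr mulmx_suml.
rewrite (reindex_inj (mulgI x^-1%g)) /=; apply: eq_big => [g|g Gg].
  by rewrite groupMl ?groupV.
have Gxg : (x^-1 * g)%g \in G by [].
have Gg' : g \in G by rewrite -(mulKVg x g) groupM.
rewrite -mulmxA !mulmxA -repr_mxM // mulKVg -!mulmxA -repr_mxM ?groupV //.
by rewrite invMg invgK.
Qed.

(** Over a closed field an intertwiner of an irreducible representation with itself is scalar; the
    scalar is read off from the trace, each summand having trace [\tr A]. *)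
Lemma avg_hom_irr n (rG : reprG n) A : mx_irreducible rG ->
  avg_hom rG rG A = (#|G|%:R * \tr A / n%:R)%:M.
Proof.
move=> irrG; have absG := group_closure_closed_field irrG.
have /is_scalar_mxP[c Tc] : is_scalar_mx (avg_hom rG rG A).
  apply: (mx_abs_irr_cent_scalar absG); apply/centgmxP => x Gx.
  by rewrite -avg_homP.
rewrite Tc; congr (_ %:M); have := congr1 mxtrace Tc.
rewrite mxtrace_scalar raddf_sum /=.
rewrite (eq_bigr (fun=> \tr A)) => [|g Gg]; last first.
  by rewrite mxtrace_mulC mulmxA -repr_mxM ?groupV // mulVg repr_mx1 mul1mx.
rewrite sumr_const => trT; rewrite mulr_natl trT -[c *+ n]mulr_natr mulfK //.
by rewrite pnatr_eq0 -lt0n (irr_dim_gt0 irrG).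
Qed.

(** The trace at [g * x] is that at [x * g]. Its diagonal entry [i] times the diagonal entry [j] of
    [rG2 g^-1] is the entry [(i, j)] of the product of the two matrices with [delta_mx i j] inserted
    between them. *)
Lemma char_convE n1 n2 (rG1 : reprG n1) (rG2 : reprG n2) x : x \in G ->
  \sum_(g in G) \tr (rG1 (g * x)%g) * \tr (rG2 g^-1%g) =
  \sum_i \sum_j (rG1 x *m avg_hom rG1 rG2 (delta_mx i j)) i j.
Proof.
move=> Gx; under [RHS]eq_bigr => i _ do
  under eq_bigr => j _ do rewrite /avg_hom mulmx_sumr summxE.
under [RHS]eq_bigr => i _ do rewrite exchange_big.
rewrite [RHS]exchange_big /=; apply: eq_bigr => g Gg.
rewrite repr_mxM // mxtrace_mulC -repr_mxM // /mxtrace big_distrl /=.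
apply: eq_bigr => i _; rewrite big_distrr /=; apply: eq_bigr => j _.
rewrite !mulmxA -repr_mxM //.
rewrite mxE (bigD1 j) //= big1 ?addr0 => [|l nlj]; last first.
  rewrite mxE big1 ?mul0r // => m _; rewrite mxE.
  by rewrite (negPf nlj) andbF mulr0.
rewrite mxE (bigD1 i) //= big1 ?addr0 => [|l nli]; last first.
  by rewrite mxE (negPf nli) mulr0.
by rewrite mxE !eqxx mulr1.
Qed.

Lemma char_conv0 n1 n2 (rG1 : reprG n1) (rG2 : reprG n2) x :
    mx_irreducible rG1 -> mx_irreducible rG2 -> ~ mx_rsim rG1 rG2 -> x \in G ->
  \sum_(g in G) \tr (rG1 (g * x)%g) * \tr (rG2 g^-1%g) = 0.
Proof.
move=> irr1 irr2 nsim Gx; rewrite char_convE //.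
rewrite big1 // => i _; rewrite big1 // => j _.
rewrite (irr_hom0 irr1 irr2 nsim (avg_homP _ _ _)).
by rewrite mulmx0 mxE.
Qed.

Lemma char_conv_irr n (rG : reprG n) x : mx_irreducible rG -> x \in G ->
  \sum_(g in G) \tr (rG (g * x)%g) * \tr (rG g^-1%g) =
  #|G|%:R / n%:R * \tr (rG x).
Proof.
move=> irrG Gx; rewrite char_convE // /mxtrace mulr_sumr.
apply: eq_bigr => i _; rewrite (bigD1 i) //= big1 ?addr0 => [|j nji].
  by rewrite avg_hom_irr // mul_mx_scalar mxE mxtrace_delta eqxx mulr1.
by rewrite avg_hom_irr // mul_mx_scalar mxE mxtrace_delta eq_sym (negPf nji) mulr0 mul0r mul0r.
Qed.

(** [rG x] is annihilated by the separable polynomial ['X^#[x] - 1], hence diagonalizable with roots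
    of unity as eigenvalues; conjugation inverts these. *)
Lemma mxtrace_conj n (rG : reprG n) x : x \in G ->
  (\tr (rG x))^*%R = \tr (rG x^-1%g).
Proof.
case: n rG => [rG Gx|n rG Gx]; first by rewrite /mxtrace !big_ord0 rmorph0.
have m_gt0 : (0 < #[x])%N := order_gt0 x.
pose p : {poly C} := 'X^#[x] - 1.
have pA0 : horner_mx (rG x) p = 0.
  rewrite rmorphB rmorphXn /= horner_mx_X rmorph1 -repr_mxX //.
  by rewrite expg_order repr_mx1 subrr.
have [rs def_p] := closed_field_poly_normal p.
have monp : p \is monic by rewrite monicXnsubC.
rewrite (monicP monp) scale1r in def_p.
have uniq_rs : uniq rs.
  rewrite -separable_prod_XsubC -def_p separable_Xn_sub_1 //.
  by rewrite pnatr_eq0 -lt0n.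
have [|P uP /diagonalizable_forPex[D /eqP]] := (diagonalizableP (rG x)).2.
  by exists rs => //; rewrite -def_p; apply/mxminpoly_minP.
rewrite mxpoly.conjumx // => PAD.
have D1 i : D 0 i ^+ #[x] = 1.
  have : horner_mx (diag_mx D) p = 0.
    by rewrite -PAD horner_mx_uconj // pA0 mulmx0 mul0mx.
  rewrite horner_mx_diag => /matrixP/(_ i i); rewrite !mxE eqxx mulr1n !hornerE.
  by move/eqP; rewrite subr_eq0 => /eqP.
have DV i : D 0 i * (D 0 i)^*%R = 1.
  rewrite -normCK; have : `|D 0 i| ^+ #[x] = 1 by rewrite -normrX D1 normr1.
  by move/eqP; rewrite pexpr_eq1 // => /eqP->; rewrite expr1n.
have AE : rG x = invmx P *m diag_mx D *m P by rewrite -PAD !mulmxA mulVmx // mul1mx mulmxKV.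
have AVE : rG x^-1%g = invmx P *m diag_mx (map_mx Num.conj D) *m P.
  set X := RHS; have AX : rG x *m X = 1%:M.
    rewrite /X AE !mulmxA mulmxK // -!mulmxA [diag_mx _ *m (_ *m P)]mulmxA.
    rewrite mulmx_diag (_ : diag_mx _ = 1%:M) ?mul1mx ?mulVmx //.
    by apply/matrixP => i j; rewrite !mxE DV.
  by rewrite -[X]mul1mx -(repr_mx1 rG) -(mulVg x) repr_mxM ?groupV // -mulmxA AX mulmx1.
rewrite AE AVE [in LHS]mxtrace_mulC [in RHS]mxtrace_mulC !mulmxA !mulmxV // !mul1mx.
rewrite !mxtrace_diag rmorph_sum.
by apply: eq_bigr => i _; rewrite mxE.
Qed.

Lemma mxtrace_rsim n1 n2 (rG1 : reprG n1) (rG2 : reprG n2) :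
  mx_rsim rG1 rG2 -> {in G, forall x, \tr (rG1 x) = \tr (rG2 x)}.
Proof.
move=> /mx_rsim_def[B [B' BB' E]] x Gx.
by rewrite E // mxtrace_mulC mulmxA BB' mul1mx.
Qed.

End SchurOrthogonality.

(** * Orthogonality relations for the characters of [G] *)

Lemma conj_zeta (R : realType) (gT : finGroupType) (A : {set gT}) :
  (zeta R[i] A)^*%R = zeta R[i] A.
Proof. by rewrite /zeta fmorph_div !rmorph_nat. Qed.

Section GroupCharacters.
Variables (R : realType) (gT : finGroupType) (k : nat).
Variables (c : 'I_k -> {set gT}) (gamma : 'I_k -> gT -> R[i]).
Hypotheses (hc : enum_classes c) (hgamma : enum_irr gamma).
Local Notation G := [set: gT]%G.

Lemma irr_char_class l g h : gamma l (g ^ h)%g = gamma l g.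
Proof.
have [d [rho [_ eg]]] := (hgamma.2 (gamma l)).2 (ex_intro _ l erefl).
rewrite !eg conjgE !repr_mxM ?inE // mxtrace_mulC -mulmxA -repr_mxM ?inE //.
by rewrite mulgV repr_mx1 mulmx1.
Qed.

Lemma irr_char_ortho l m :
  \sum_g gamma l g * (gamma m g)^*%R = (#|[set: gT]| * (l == m))%:R.
Proof.
have [d [rho [irr eg]]] := (hgamma.2 (gamma l)).2 (ex_intro _ l erefl).
have [d' [rho' [irr' eg']]] := (hgamma.2 (gamma m)).2 (ex_intro _ m erefl).
transitivity (\sum_(g in G) \tr (rho (g * 1)%g) * \tr (rho' g^-1%g)).
  by apply: eq_big => [g|g _]; rewrite ?inE // eg eg' mxtrace_conj ?inE // mulg1.
case: eqVneq eg' irr' => [<-|nlm] eg' irr'.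
  transitivity (\sum_(g in G) \tr (rho (g * 1)%g) * \tr (rho g^-1%g)).
    by apply: eq_bigr => g _; congr (_ * _); rewrite -eg -eg'.
  rewrite char_conv_irr // repr_mx1 mxtrace1 mulfVK ?muln1 //.
  by rewrite pnatr_eq0 -lt0n (irr_dim_gt0 irr).
rewrite muln0 char_conv0 // => sim; case/eqP: nlm; apply: hgamma.1.
by apply/funext => g; rewrite eg eg' (mxtrace_rsim sim) ?inE.
Qed.

Lemma enum_class_repr i : c i = (fingroup.repr (c i) ^: [set: gT])%g /\ (0 < #|c i|)%N.
Proof.
have /repr_classesP[_ e] : c i \in classes G by apply/hc.2; exists i.
by split=> //; rewrite e card_gt0; apply/set0Pn; exists (fingroup.repr (c i)); apply: class_refl.
Qed.

Lemma enum_classJ i g h : ((g ^ h)%g \in c i) = (g \in c i).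
Proof.
have [-> _] := enum_class_repr i; rewrite memJ_norm //.
by apply: (fintype.subsetP (class_norm _ G)); rewrite inE.
Qed.

Lemma sum_enum_classes (F : gT -> R[i]) : (forall g h, F (g ^ h)%g = F g) ->
  \sum_g F g = \sum_i #|c i|%:R * F (fingroup.repr (c i)).
Proof.
move=> FJ; transitivity (\sum_(g in G) F g).
  by apply: eq_bigl => g; rewrite inE.
rewrite sum_by_classes => [|g h _ _]; last exact: FJ.
transitivity (\sum_(A in [set c i | i : 'I_k]) #|A|%:R * F (fingroup.repr A)).
  apply: eq_bigl => A; apply/idP/imsetP => [/hc.2[i ->]|[i _ ->]]; first by exists i.
  by apply/hc.2; exists i.
by rewrite big_imset // => i j _ _; apply: hc.1.
Qed.

(** Row orthogonality, grouped by classes, says [X *m Y = 1]. There are as many characters as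
    classes, so the matrices are square and [Y *m X = 1] follows, which is column orthogonality. *)
Lemma irr_char_ortho2 i j :
  \sum_l (class_value (gamma l) (c i))^*%R * class_value (gamma l) (c j) =
  zeta R[i] (c i) * (i == j)%:R.
Proof.
pose X : 'M[R[i]]_k := \matrix_(l, i) class_value (gamma l) (c i).
pose Y : 'M[R[i]]_k := \matrix_(i, l) ((zeta R[i] (c i))^-1 * (X l i)^*%R).
have g0 : #|[set: gT]|%:R != 0 :> R[i] by rewrite pnatr_eq0 -lt0n cardG_gt0.
have /mulmx1C/matrixP/(_ i j) : X *m Y = 1%:M.
  apply/matrixP => l m; rewrite !mxE; apply: (mulfI g0).
  rewrite mulr_natr -mulrnA -irr_char_ortho sum_enum_classes => [|g h]; last first.
    by rewrite !irr_char_class.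
  rewrite mulr_sumr; apply: eq_bigr => n _; rewrite !mxE /zeta invf_div.
  by rewrite /class_value; field.
rewrite !mxE => e; have z0 : zeta R[i] (c i) != 0.
  by rewrite /zeta mulf_neq0 // invr_eq0 pnatr_eq0 -lt0n (enum_class_repr i).2.
rewrite -e mulr_sumr; apply: eq_bigr => l _; rewrite !mxE.
by rewrite !mulrA divff // mul1r.
Qed.

(** Column orthogonality leaves only the diagonal of the double sum over classes. This identifies
    the Pochhammer parameter of the Ewens distribution with that of [multi_zmeasure]. *)
Lemma sum_aparam (z : 'I_k -> R[i]) :
  \sum_l aparam c gamma z l * (aparam c gamma z l)^*%R =
  \sum_i z i * (z i)^*%R / zeta R[i] (c i).
Proof.
have z0 i : zeta R[i] (c i) != 0.
  by rewrite /zeta mulf_neq0 ?invr_eq0 ?pnatr_eq0 -?lt0n ?(enum_class_repr i).2 ?cardG_gt0.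
transitivity (\sum_i \sum_j z i / zeta R[i] (c i) * (z j)^*%R / zeta R[i] (c j) *
  \sum_l (class_value (gamma l) (c i))^*%R * class_value (gamma l) (c j)).
  transitivity (\sum_l \sum_i \sum_j z i / zeta R[i] (c i) * (z j)^*%R / zeta R[i] (c j) *
    ((class_value (gamma l) (c i))^*%R * class_value (gamma l) (c j))).
    apply: eq_bigr => l _; rewrite /aparam rmorph_sum mulr_suml.
    apply: eq_bigr => i _; rewrite mulr_sumr; apply: eq_bigr => j _.
    by rewrite !rmorphM fmorphV /= conjCK conj_zeta; ring.
  rewrite exchange_big; apply: eq_bigr => i _; rewrite exchange_big.
  by apply: eq_bigr => j _; rewrite mulr_sumr.
apply: eq_bigr => i _; rewrite (bigD1 i) //= [X in _ + X]big1 ?addr0 => [|j nji].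
  rewrite irr_char_ortho2 eqxx mulr1 mulfVK //.
  by rewrite mulrAC.
by rewrite irr_char_ortho2 eq_sym (negPf nji) !mulr0.
Qed.

End GroupCharacters.

(** * Cycle-products under the canonical projection *)

Section Cycles.
Local Open Scope group_scope.

(** Lengths of duplicate-free closed trajectories bound each other: returning to [x] after [b] steps
    would repeat [x] in a trajectory longer than [b]. *)
Lemma traject_porbit_unique (T : finType) (s : {perm T}) x n :
  uniq (traject s x n) -> iter n s x = x -> (0 < n)%N -> #|porbit s x| = n.
Proof.
have le a b : uniq (traject s x a) -> iter b s x = x -> (0 < b)%N -> (a <= b)%N.
  move=> ua sb b_gt0; rewrite leqNgt; apply/negP => lt_ba.
  have := nth_uniq x (i := 0) (j := b) _ _ ua.
  rewrite size_traject => /(_ (ltn_trans b_gt0 lt_ba) lt_ba).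
  by rewrite !nth_traject ?(ltn_trans b_gt0) // sb eqxx => /esym/eqP e0; rewrite -e0 in b_gt0.
move=> un sn n_gt0; apply/eqP; rewrite eqn_leq.
apply/andP; split; apply: le => //.
- exact: uniq_traject_porbit.
- exact: iter_porbit.
- by rewrite lt0n card_porbit_neq0.
Qed.

(** Used to compute [cycle_product] from an explicitly constructed cycle. *)
Lemma fcycle_porbit (T : finType) (s : {perm T}) x p :
  fcycle s (x :: p) -> uniq (x :: p) -> traject s x #|porbit s x| = x :: p.
Proof.
move=> /= cp up; have /fpathP[n def_p] := cp.
have sz_n : n = (size p).+1 by rewrite -(size_traject s (s x) n) -def_p size_rcons.
have e : x :: p = traject s x n.
  have : rcons (x :: p) x = traject s x n.+1 by rewrite /= def_p.
  by rewrite trajectSr => /rcons_inj[].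
rewrite (@traject_porbit_unique _ _ _ n) -?e ?sz_n //.
have : last x (rcons p x) = last x (traject s (s x) n) by rewrite def_p.
by rewrite last_rcons last_traject sz_n.
Qed.

Lemma fcycle_traject_porbit (T : finType) (s : {perm T}) x :
  fcycle s (traject s x #|porbit s x|).
Proof.
case def_n: #|_| (iter_porbit s x) (card_porbit_neq0 s x) => [//|n] sn _.
have -> : fcycle s (traject s x n.+1) = fpath s x (traject s (s x) n.+1).
  by rewrite (trajectSr s (s x)) -iterSr sn.
exact: fpath_traject.
Qed.

Variables (gT : finGroupType) (A : {set gT}).
Hypothesis AJ : forall g h, (g ^ h \in A) = (g \in A).

Lemma cycle_productE n (x : wreath gT n) i p :
  fcycle (wperm x) (i :: p) -> uniq (i :: p) ->
  cycle_product x i = \prod_(j <- rev (i :: p)) wbase x j.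
Proof. by move=> cp up; rewrite /cycle_product (fcycle_porbit cp up). Qed.

(** Starting one point later moves the last factor [wbase x i] to the front, which is a
    conjugation. *)
Lemma cycle_product_perm n (x : wreath gT n) i :
  (cycle_product x (wperm x i) \in A) = (cycle_product x i \in A).
Proof.
set s := wperm x.
have := fcycle_traject_porbit s i; have := uniq_traject_porbit s i.
case def_n: #|porbit s i| (card_porbit_neq0 s i) => [//|n'] _ /= up cp.
rewrite (cycle_productE cp up).
have cp' : fcycle s (rcons (traject s (s i) n') i).
  by rewrite -[rcons _ _](rot1_cons i) rot_cycle.
have up' : uniq (rcons (traject s (s i) n') i) by rewrite -rot1_cons rot_uniq.
have [p def_p] : exists p, rcons (traject s (s i) n') i = s i :: p.
  case: (n') cp => [/=|m _]; last by exists (rcons (traject s (s (s i)) m) i).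
  by rewrite andbT => /eqP->; exists [::].
move: cp' up'; rewrite def_p => cp' up'.
rewrite (cycle_productE cp' up') -def_p rev_rcons rev_cons -cats1.
rewrite big_cons big_cat big_seq1 -(AJ (_ * wbase x i) (wbase x i)^-1).
by rewrite conjgE invgK mulgK.
Qed.

Lemma cycle_product_porbit n (x : wreath gT n) i j :
  j \in porbit (wperm x) i ->
  (cycle_product x j \in A) = (cycle_product x i \in A).
Proof.
case/porbitP=> m ->; elim: m => [|m IHm]; first by rewrite expg0 perm1.
by rewrite expgSr permM cycle_product_perm.
Qed.

Lemma mem_cycles_of_type n (x : wreath gT n) i :
  (porbit (wperm x) i \in cycles_of_type A x) = (cycle_product x i \in A).
Proof.
rewrite inE imset_f //=; apply/existsP/idP => [[j /andP[xj]]|xi].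
  by rewrite (cycle_product_porbit xj).
by exists i; rewrite porbit_id.
Qed.

Lemma cycles_of_typeP n (x : wreath gT n) C :
  reflect (exists2 i, C = porbit (wperm x) i & cycle_product x i \in A)
          (C \in cycles_of_type A x).
Proof.
apply: (iffP idP) => [xC|[i -> xi]]; last by rewrite mem_cycles_of_type.
have : C \in porbits (wperm x) by move: xC; rewrite inE => /andP[].
case/imsetP=> i _ def_C; exists i => //.
by rewrite -mem_cycles_of_type -def_C.
Qed.

Section Projection.
Variables (n : nat) (y : wreath gT n.+1).
Let x := wproj y.
Let s := wperm y.
Let s' := wperm x.
Local Notation lft := (lift (@ord_max n)).

(** The cycle of [y] lying over a cycle [C] of [x]: the removed point [ord_max] is restored exactly
    when [C] contains its image. *)
Definition lift_cycle (C : {set 'I_n}) : {set 'I_n.+1} :=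
  lft @: C :|: [set i | (i == ord_max) && (s ord_max \in lft @: C)].

Lemma lift_cycle_inj : injective lift_cycle.
Proof.
move=> C D /setP eCD; apply/setP => i; have := eCD (lft i).
by rewrite !inE lift_maxF !orbF !mem_imset //; apply: lift_inj.
Qed.

(** The permutations [s] and [s'] differ only at the predecessor of [ord_max], which [s'] sends
    straight to [j]. As [q] avoids [j], only the last step is rerouted. *)
Lemma wproj_path j q k : s ord_max = lft j ->
  fpath s' k (rcons q j) -> j \notin q ->
  fpath s (lft k) (rcons (map lft q) ord_max).
Proof.
move=> sj; elim: q k => [|k1 q IHq] k /=.
  rewrite !andbT => /eqP s'k _; have := lift_wproj y k.
  rewrite -/x -/s' -/s s'k; case: eqP => // nmax; rewrite -sj => /perm_inj/eqP.
  by rewrite eq_sym lift_maxF.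
case/andP=> /eqP s'k pk; rewrite inE negb_or => /andP[njk njq].
rewrite IHq // andbT; have := lift_wproj y k; rewrite -/x -/s' -/s s'k.
case: eqP => [_|_ -> //]; rewrite sj => /lift_inj e.
by rewrite e eqxx in njk.
Qed.

Lemma wproj_path_off k q : (forall j, s ord_max = lft j -> j \notin q) ->
  fpath s' k q -> fpath s (lft k) (map lft q).
Proof.
elim: q k => [//|k1 q IHq] k nj /= /andP[/eqP s'k pq].
rewrite IHq // => [|j /nj]; last by rewrite inE negb_or => /andP[].
rewrite andbT; have := lift_wproj y k; rewrite -/x -/s' -/s s'k.
case: eqP => [_ e|_ -> //]; have := nj k1 (esym e).
by rewrite inE eqxx.
Qed.

Lemma wbase_proj k : s ord_max != lft k -> wbase x k = wbase y (lft k).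
Proof. by move=> ne; rewrite ffunE (negPf ne). Qed.

(* Inserting the point [ord_max] just before the image [lft j] of [ord_max]
   leaves the cycle-product read from [j] unchanged. *)
Lemma wproj_cycle_through j : s ord_max = lft j ->
  porbit s ord_max = ord_max |: lft @: porbit s' j /\
  cycle_product y ord_max = cycle_product x j.
Proof.
move=> sj; have := fcycle_traject_porbit s' j; have := uniq_traject_porbit s' j.
have := porbit_traject s' j.
case def_n: #|porbit s' j| (card_porbit_neq0 s' j) => [//|n'] _ /=.
set q := traject _ _ n' => mem_q uq cq; have /andP[njq _] := uq.
have cp : fcycle s (ord_max :: map lft (j :: q)).
  by rewrite /= sj eqxx; apply: (wproj_path sj).
have up : uniq (ord_max :: map lft (j :: q)).
  rewrite cons_uniq (map_inj_uniq (@lift_inj _ ord_max)) (uq : uniq (j :: q)) andbT.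
  by apply/mapP => -[k _ /esym/eqP]; rewrite lift_maxF.
split.
  apply/setP=> i; rewrite porbit_traject (fcycle_porbit cp up) !inE.
  case: eqP => //= _; apply/idP/imsetP => [|[k]].
    rewrite -in_cons -map_cons => /mapP[k qk ->]; exists k => //.
    by rewrite mem_q.
  by rewrite mem_q => qk ->; rewrite -in_cons -map_cons map_f.
rewrite (cycle_productE cp up) (cycle_productE cq uq) /= !rev_cons -!cats1.
(* The last two factors, at [lft j] and [ord_max], are exactly those that [wproj] merges into
   [wbase x j]. *)
rewrite !big_cat !big_seq1 /= -mulgA; congr (_ * _); last by rewrite ffunE -/s sj eqxx.
rewrite -map_rev big_map; apply: eq_big_seq => k; rewrite mem_rev => qk.
rewrite wbase_proj // sj (inj_eq (@lift_inj _ ord_max)).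
by apply: contraNneq njq => ->.
Qed.

Lemma wproj_cycle_off i : (forall j, s ord_max = lft j -> j \notin porbit s' i) ->
  porbit s (lft i) = lft @: porbit s' i /\
  cycle_product y (lft i) = cycle_product x i.
Proof.
move=> nj; have := fcycle_traject_porbit s' i; have := uniq_traject_porbit s' i.
have := porbit_traject s' i.
case def_n: #|porbit s' i| (card_porbit_neq0 s' i) => [//|n'] _ /=.
set q := traject _ _ n' => mem_q uq cq.
have nj' j : s ord_max = lft j -> j \notin i :: q by rewrite -mem_q; apply: nj.
have cp : fcycle s (lft i :: map lft q).
  rewrite /= -map_rcons wproj_path_off // => j /nj'.
  by rewrite mem_rcons.
have up : uniq (lft i :: map lft q).
  by rewrite -map_cons (map_inj_uniq (@lift_inj _ ord_max)).
split.
  apply/setP=> k; rewrite porbit_traject (fcycle_porbit cp up) -map_cons.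
  apply/mapP/imsetP => -[l]; first by rewrite -mem_q; exists l.
  by rewrite mem_q; exists l.
rewrite (cycle_productE cp up) (cycle_productE cq uq).
rewrite -map_cons -map_rev big_map; apply: eq_big_seq => k.
rewrite mem_rev => qk; rewrite wbase_proj //; apply/eqP => /nj'.
by rewrite qk.
Qed.

(** On the cycle through [ord_max] the cycle-products agree when read from [ord_max] and from its
    image; from other starting points only membership in the conjugation-stable set [A] is
    compared. *)
Lemma wproj_cycle i :
  porbit s (lft i) = lift_cycle (porbit s' i) /\
  (cycle_product y (lft i) \in A) = (cycle_product x i \in A).
Proof.
rewrite /lift_cycle.
have [/imsetP[j i_j sj]|nj] := boolP (s ord_max \in lft @: porbit s' i).
  have [orb_max cp_max] := wproj_cycle_through sj.
  have eij : porbit s' j = porbit s' i by apply/eqP; rewrite eq_porbit_mem.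
  have max_i : lft i \in porbit s ord_max.
    by rewrite orb_max eij !inE lift_maxF imset_f // porbit_id.
  split; last first.
    by rewrite (cycle_product_porbit max_i) cp_max (cycle_product_porbit i_j).
  have -> : porbit s (lft i) = porbit s ord_max by apply/eqP; rewrite eq_porbit_mem.
  by rewrite orb_max eij; apply/setP=> k; rewrite !inE andbT orbC.
have [|-> ->] := @wproj_cycle_off i.
  by move=> j sj; apply: contra nj; rewrite sj => /(imset_f lft).
by split=> //; apply/setP=> k; rewrite !inE andbF orbF.
Qed.

(** The cycles of [y] are the lifts of those of [x], together with the singleton of [ord_max] when
    that point is fixed. *)
Lemma ncycles_wproj :
  ncycles A y = (ncycles A x + ((s ord_max == ord_max) && (wbase y ord_max \in A)))%N.
Proof.
set b := _ && _.
have fixed_max : s ord_max = ord_max ->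
    porbit s ord_max = [set ord_max] /\ cycle_product y ord_max = wbase y ord_max.
  move=> smax; have cp : fcycle s [:: ord_max] by rewrite /= smax eqxx.
  split; last by rewrite (cycle_productE cp) // big_seq1.
  by apply/setP=> i; rewrite porbit_traject (fcycle_porbit cp) // !inE.
rewrite /ncycles; have -> : cycles_of_type A y = lift_cycle @: cycles_of_type A x :|:
                        [set C | b && (C == [set ord_max])].
  apply/setP=> C; apply/cycles_of_typeP/setUP => [[i -> yi]|].
    have lifted k : cycle_product y (lft k) \in A ->
        porbit s (lft k) \in lift_cycle @: cycles_of_type A x.
      have [-> ->] := wproj_cycle k => xk.
      by rewrite imset_f // mem_cycles_of_type.
    case: (unliftP ord_max i) yi => [k|] -> yi; first by left; apply: lifted.
    case: (unliftP ord_max (s ord_max)) => [j sj|smax].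
      left; rewrite (_ : porbit _ _ = porbit s (lft j)); last first.
        by apply/eqP; rewrite eq_porbit_mem porbit_sym -sj (mem_porbit s 1).
      by rewrite lifted // -sj cycle_product_perm.
    right; have [-> eA] := fixed_max smax.
    by rewrite inE /b smax -eA yi !eqxx.
  case=> [/imsetP[D /cycles_of_typeP[i -> xi] ->]|].
    by have [orb eA] := wproj_cycle i; exists (lft i); rewrite ?orb ?eA.
  rewrite inE => /andP[/andP[/eqP smax yA] /eqP->]; have [orb eA] := fixed_max smax.
  by exists ord_max; rewrite ?orb ?eA.
rewrite cardsU disjoint_setI0 ?cards0 ?subn0; last first.
  rewrite finset.disjoints_subset.
  apply/fintype.subsetP=> _ /imsetP[D /cycles_of_typeP[i -> xi] ->].
  rewrite !inE negb_and; apply/orP; right; apply/eqP => /setP/(_ (lft i)).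
  by rewrite !inE lift_maxF imset_f // porbit_id.
rewrite card_imset //; last exact: lift_cycle_inj.
congr (_ + _)%N; case: b => /=; last first.
  by apply/eqP; rewrite cards_eq0; apply/eqP/setP=> C; rewrite !inE.
by rewrite -(cards1 [set ord_max : 'I_n.+1]); apply: eq_card => C; rewrite !inE.
Qed.

End Projection.

(** Since [wembed u] fixes [ord_max] with trivial entry there, the correction term of
    [ncycles_wproj] is the same for both elements and cancels. Hence the cocycles do not depend on
    the level. *)
Lemma ncycles_mul_embed n (y : wreath gT n.+1) (u : wreath gT n) :
  (ncycles A (y * wembed u))%:Z - (ncycles A y)%:Z =
  (ncycles A (wproj y * u))%:Z - (ncycles A (wproj y))%:Z :> int.
Proof.
rewrite (ncycles_wproj y) (ncycles_wproj (y * wembed u)) wprojMr.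
rewrite wpermM wperm_embed_max wbaseM.
set b := _ && _; set b' := _ && _.
have -> : b' = b; last by rewrite !PoszD; lia.
rewrite /b' /b; case: eqP => //= ymax.
have -> : (wperm y)^-1 ord_max = ord_max by rewrite -[in LHS]ymax permK.
by rewrite wbase_embed_max mulg1.
Qed.

End Cycles.

(** * The character as a finite sum *)

Section CylinderIntegral.
Variables (R : realType) (gT : finGroupType) (P : probability (vpermM gT) R).
Local Open Scope classical_set_scope.

Definition level_set n (x : wreath gT n) : set (vpermM gT) := [set y | vproj y n = x].

Lemma measurable_level_set n (x : wreath gT n) : measurable (level_set x).
Proof.
by apply: sub_sigma_algebra; exists n, [set x].
Qed.

(** A function of the [n]-th projection is a finite linear combination of indicators of
    cylinders. *)
Lemma Rintegral_level n (f : wreath gT n -> R) :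
  Rintegral P setT (fun y => f (vproj y n)) =
  (\sum_x f x * fine (P (level_set x)))%R.
Proof.
rewrite /Rintegral.
have -> : (fun y => (f (vproj y n))%:E) =
          (fun y => \sum_(x : wreath gT n) (f x)%:E * (\1_(level_set x) y)%:E)%E.
  apply/funext => y; rewrite (bigD1 (vproj y n)) //= big1 => [|x nx].
    by rewrite indicE mem_set // mule1 adde0.
  by rewrite indicE memNset ?mule0 // => e; rewrite e eqxx in nx.
have intI x : P.-integrable setT (fun y => (\1_(level_set x) y)%:E).
  by apply: integrable_indic; apply: measurable_level_set.
rewrite integral_sum //; last by move=> x; apply: integrableZl.
rewrite (eq_bigr (fun x => (f x)%:E * P (level_set x))%E) => [|x _]; last first.
    have mx := measurable_level_set x.
  by rewrite integralZl // integral_indic // setIT.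
rewrite (eq_bigr (fun x => (f x * fine (P (level_set x)))%:E)) => [|x _].
  by rewrite sumEFin.
by rewrite EFinM fineK // fin_num_measure //; apply: measurable_level_set.
Qed.

End CylinderIntegral.

(** * Weights of the z-measure as squared moduli of Schur values *)

Section ZMeasureTheory.
Variable R : realType.
Implicit Types (a : R[i]) (lam : seq nat).

Lemma natrS_neq0 m : m.+1%:R != 0 :> R[i].
Proof. by rewrite pnatr_eq0. Qed.

Lemma pochhammer_gt0 (b : R[i]) m : 0 < b -> 0 < pochhammer b m.
Proof. by move=> b_gt0; apply: prodr_gt0 => i _; rewrite ltr_wpDr. Qed.

(** For nonzero [a] the Pochhammer symbol is positive, so the prefactors cancel and both readings of
    the product agree. *)
Lemma zfactorE a lam : zfactor a lam = zprod a lam.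
Proof.
rewrite /zfactor; case: eqVneq => // a0; rewrite /zmeasure mulrA -[RHS]mul1r.
congr (_ * _).
have p0 : pochhammer (a * a^*%R) (sumn lam) != 0.
  by rewrite gt_eqF // pochhammer_gt0 // -normCK exprn_gt0 // normr_gt0.
have f0 : (sumn lam)`!%:R != 0 :> R[i] by rewrite pnatr_eq0 -lt0n fact_gt0.
by field; rewrite p0 f0.
Qed.

Lemma schur_cst_conj a lam : sorted geq lam ->
  (schur (fun=> a) lam)^*%R = schur (fun=> a^*%R) lam.
Proof.
move=> slam; rewrite !schur_cst //; try exact: natrS_neq0.
rewrite rmorph_prod; apply: eq_bigr => i _; rewrite rmorph_prod.
apply: eq_bigr => j _.
by rewrite /box_content fmorph_div rmorphD rmorphB !rmorph_nat.
Qed.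

Lemma zprod_schur a lam : sorted geq lam ->
  zprod a lam = schur (fun=> a) lam * (schur (fun=> a) lam)^*%R.
Proof.
move=> slam; rewrite schur_cst_conj // !schur_cst //; try exact: natrS_neq0.
rewrite -big_split; apply: eq_bigr => i _; rewrite -big_split.
by apply: eq_bigr => j _; rewrite /= mulf_div.
Qed.

End ZMeasureTheory.

(** * Reading the cocycles at a given level *)

Section Levels.
Variable gT : finGroupType.
Local Open Scope group_scope.

Lemma wext1 n : wext (1 : wreath gT n) = fun i => (1, i).
Proof.
apply/funext => i; rewrite /wext; case: insubP => // j _ <-.
by rewrite ffunE perm1.
Qed.

Lemma at_level1 n : at_level (Ginf1 gT) n = 1.
Proof.
have e1 : wext (1 : wreath gT n) = sval (Ginf1 gT) by rewrite /= !wext1.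
by apply: wext_inj; rewrite at_levelE //; exists 1.
Qed.

Lemma cocycle_level k (c : 'I_k -> {set gT}) (hc : enum_classes c)
    n (x : wreath gT n) l (y : vperm gT) :
  cocycle c l y (Ginf_of x, Ginf1 gT) =
  (ncycles (c l) (y n * x))%:Z - (ncycles (c l) (y n))%:Z.
Proof.
set W := (_, _); set w := Ginf_of x.
pose delta m : int := (ncycles (c l) (y m * at_level w m))%:Z - (ncycles (c l) (y m))%:Z.
have deltaD m d : in_level w m -> delta (m + d)%N = delta m.
  move=> wm; suff [] : in_level w (m + d) /\ delta (m + d)%N = delta m by [].
  elim: d => [|d [wd IHd]]; first by rewrite addn0.
  rewrite addnS; have [wS eS] := at_levelS wd; split=> //.
  rewrite -IHd /delta eS ncycles_mul_embed ?vprojP //.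
  exact: enum_classJ.
have wn : in_level w n by exists x.
have wN : in_level w (pair_level W) by apply/Ginf_levelP/leq_maxl.
transitivity (delta (pair_level W)).
  by rewrite /cocycle /delta vactE // at_level1 invg1 mul1g.
rewrite -(at_level_of x) -/w -/(delta n).
(* [Ginf_level] comes from a choice, so [pair_level W] may lie on either side of [n]. *)
case/orP: (leq_total n (pair_level W)) => /subnKC <-; first exact: deltaD.
by rewrite deltaD.
Qed.

End Levels.

(** * Expansion of the character in irreducible characters *)

Section Main.
Variables (R : realType) (gT : finGroupType) (k : nat).
Variables (c : 'I_k -> {set gT}) (gamma : 'I_k -> gT -> R[i]) (z : 'I_k -> R[i]).
Variable P : probability (vpermM gT) R.
Hypotheses (hc : enum_classes c) (hgamma : enum_irr gamma).
Hypothesis hz : forall l, z l != 0.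
Hypothesis hP : is_ewens c (fun l => Normc.normc (z l) ^+ 2) P.

(** For [u = z] this is the function phi, whose squared modulus is the numerator of the Ewens
    distribution. *)
Definition class_weight (u : 'I_k -> R[i]) n (x : wreath gT n) : R[i] :=
  \prod_l u l ^+ ncycles (c l) x.

Lemma class_weightE u n (x : wreath gT n) :
  class_weight u x = \prod_l \prod_(C in cycles_of_type (c l) x) u l.
Proof. by apply: eq_bigr => l _; rewrite prodr_const. Qed.

Lemma conj_class_weight u n (x : wreath gT n) :
  (class_weight u x)^*%R = class_weight (fun l => (u l)^*%R) x.
Proof. by rewrite rmorph_prod; apply: eq_bigr => l _; rewrite rmorphXn. Qed.

Lemma cintegral_level n (F : wreath gT n -> R[i]) :
  cintegral P (fun y => F (vproj y n)) =
  \sum_x F x * (ewens c (fun l => Normc.normc (z l) ^+ 2) x)%:C.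
Proof.
rewrite /cintegral !(Rintegral_level P (fun x => complex.Re (F x))).
rewrite (Rintegral_level P (fun x => complex.Im (F x))).
under eq_bigr => x _ do rewrite hP.
under [X in _ +i* X]eq_bigr => x _ do rewrite hP.
elim/big_rec3: _ => //= x s t u _ <-.
by case: (F x) => a b; rewrite /GRing.mul /=; simpc.
Qed.

Lemma normc_sqr (u : R[i]) : (Normc.normc u ^+ 2)%:C = u * u^*%R.
Proof. by rewrite -normCK rmorphXn. Qed.

Lemma ewens_class_weight n (y : wreath gT n) :
  (ewens c (fun l => Normc.normc (z l) ^+ 2) y)%:C =
  (#|[set: gT]|%:R ^+ n *
     pochhammer (\sum_l aparam c gamma z l * (aparam c gamma z l)^*%R) n)^-1 *
  (class_weight z y * (class_weight z y)^*%R).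
Proof.
rewrite /ewens mulrC rmorphM fmorphV rmorphM rmorphXn rmorph_nat; congr (_ * _).
  congr (_ * _)^-1; rewrite (sum_aparam hc hgamma) rmorph_prod.
  apply: eq_bigr => i _; rewrite rmorphD rmorph_nat rmorph_sum; congr (_ + _).
  by apply: eq_bigr => l _; rewrite fmorph_div /= normc_sqr /zeta fmorph_div !rmorph_nat.
rewrite conj_class_weight -big_split rmorph_prod; apply: eq_bigr => l _.
by rewrite rmorphXn /= normc_sqr exprMn.
Qed.

Lemma chi_z_sum n (x : wreath gT n) :
  chi_z c z P (Ginf_of x) =
  (#|[set: gT]|%:R ^+ n *
     pochhammer (\sum_l aparam c gamma z l * (aparam c gamma z l)^*%R) n)^-1 *
  \sum_y class_weight z (y * x)%g * (class_weight z y)^*%R.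
Proof.
rewrite /chi_z /L2dot.
pose F (y : wreath gT n) :=
  \prod_l z l ^ ((ncycles (c l) (y * x)%g)%:Z - (ncycles (c l) y)%:Z).
rewrite [X in cintegral P X](_ : _ = fun y => F (vproj y n)); last first.
  apply/funext => y; rewrite /genreg rmorph1 mulr1 mul1r; apply: eq_bigr => l _.
  by rewrite cocycle_level.
rewrite cintegral_level mulr_sumr; apply: eq_bigr => y _.
rewrite ewens_class_weight mulrCA; congr (_ * _); rewrite mulrA; congr (_ * _).
(* One factor phi(y) of the Ewens weight turns the cocycle power into phi(y x); combining the
   exponents uses [z l != 0]. *)
rewrite -big_split; apply: eq_bigr => l _ /=.
by rewrite [z l ^+ ncycles (c l) y]exprnP -expfzDr // subrK.
Qed.

Variables (n : nat) (d : multiyoung k n -> nat).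
Variable rho : forall L, mx_representation R[i] [set: wreath gT n] (d L).
Hypothesis hrho : std_labelling c gamma rho.

Definition schur_weight (L : multiyoung k n) : R[i] :=
  \prod_l schur (fun=> aparam c gamma z l) (diagram L l).

Lemma diagram_sorted (L : multiyoung k n) l : sorted geq (diagram L l).
Proof. by have /andP[/forallP/(_ l)/andP[]] := valP L. Qed.

Lemma class_weight_expansion (x : wreath gT n) :
  class_weight z x = \sum_L \tr (rho L x) * schur_weight L.
Proof.
have [_ _ _ /(_ (fun _ i => (z i)^*%R) x)] := hrho.
rewrite -class_weightE -conj_class_weight => /(congr1 Num.conj).
rewrite conjCK => ->; rewrite rmorph_sum; apply: eq_bigr => L _.
rewrite rmorphM /= conjCK; congr (_ * _); rewrite rmorph_prod.
apply: eq_bigr => l _.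
(* The specialized variables do not depend on [r], so all power sums of the [l]-th family equal one
   constant, the conjugate of [aparam c gamma z l]. *)
pose b := \sum_i (zeta R[i] (c i))^-1 * class_value (gamma l) (c i) * (z i)^*%R.
have -> : psum_irr c gamma (fun _ i => (z i)^*%R) l = fun=> b by [].
apply: etrans (schur_cst_conj b (diagram_sorted L l)) _.
suff -> : b^*%R = aparam c gamma z l by [].
rewrite rmorph_sum; apply: eq_bigr => i _; rewrite !rmorphM fmorphV /= conjCK.
by rewrite conj_zeta; ring.
Qed.

Lemma irr_labelled L : mx_irreducible (rho L).
Proof. by case: hrho => irr _ _ _. Qed.

(** Expanding both factors gives convolutions of irreducible characters; the cross terms vanish
    because distinct labels carry non-similar representations. *)
Lemma class_weight_conv (x : wreath gT n) :
  \sum_y class_weight z (y * x)%g * (class_weight z y)^*%R =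
  #|[set: wreath gT n]|%:R *
  \sum_L schur_weight L * (schur_weight L)^*%R * (\tr (rho L x) / (d L)%:R).
Proof.
transitivity (\sum_L \sum_L' schur_weight L * (schur_weight L')^*%R *
    \sum_(y in [set: wreath gT n]%G) \tr (rho L (y * x)%g) * \tr (rho L' y^-1%g)).
  transitivity (\sum_y \sum_L \sum_L' schur_weight L * (schur_weight L')^*%R *
      (\tr (rho L (y * x)%g) * \tr (rho L' y^-1%g))).
    apply: eq_bigr => y _; rewrite !class_weight_expansion rmorph_sum mulr_suml.
    apply: eq_bigr => L _; rewrite mulr_sumr; apply: eq_bigr => L' _.
    by rewrite rmorphM -mxtrace_conj ?inE //=; ring.
  rewrite exchange_big; apply: eq_bigr => L _.
  rewrite exchange_big; apply: eq_bigr => L' _; rewrite mulr_sumr.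
  by apply: eq_bigl => y; rewrite inE.
rewrite mulr_sumr; apply: eq_bigr => L _.
rewrite (bigD1 L) //= [X in _ + X]big1 ?addr0 => [|L' nL].
  rewrite char_conv_irr ?inE //; last exact: irr_labelled.
  by ring.
rewrite char_conv0 ?mulr0 ?inE //; try exact: irr_labelled.
by move=> sim; case: hrho => _ inj _ _; rewrite (inj _ _ sim) eqxx in nL.
Qed.

Lemma card_wreath : #|[set: wreath gT n]| = (#|[set: gT]| ^ n * n`!)%N.
Proof.
rewrite cardsT (bij_eq_card (f := @pair_of_wreath gT n)).
  by rewrite card_prod card_ffun card_ord cardsT -card_Sn.
by exists (@wreath_of_pair gT n); [exact: pair_of_wreathK | case].
Qed.

Lemma multi_zmeasureE (L : multiyoung k n) :
  multi_zmeasure c gamma z L =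
  n`!%:R / pochhammer (\sum_l aparam c gamma z l * (aparam c gamma z l)^*%R) n
  * (schur_weight L * (schur_weight L)^*%R).
Proof.
rewrite /multi_zmeasure; congr (_ * _); rewrite rmorph_prod -big_split.
by apply: eq_bigr => l _; rewrite zfactorE zprod_schur ?diagram_sorted.
Qed.

Lemma chi_z_expansion (x : wreath gT n) :
  chi_z c z P (Ginf_of x) =
  \sum_L multi_zmeasure c gamma z L * (\tr (rho L x) / (d L)%:R).
Proof.
rewrite chi_z_sum class_weight_conv mulrA mulr_sumr; apply: eq_bigr => L _.
rewrite multi_zmeasureE mulrA; congr (_ * _); congr (_ * _).
have : #|[set: gT]|%:R ^+ n != 0 :> R[i].
  by rewrite expf_neq0 // pnatr_eq0 -lt0n cardG_gt0.
(* The order of the wreath product cancels the power of the order of [G] in the Ewens normalization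
   and leaves the factorial of [n]. *)
rewrite card_wreath natrM natrX; move: (_ ^+ n) (pochhammer _ n) => u p u0.
by rewrite invfM mulrACA mulVf // mul1r mulrC.
Qed.

Lemma multi_zmeasure_ge0 (L : multiyoung k n) : 0 <= multi_zmeasure c gamma z L.
Proof.
rewrite multi_zmeasureE mulr_ge0 ?mul_conjC_ge0 // divr_ge0 //.
by apply: prodr_ge0 => i _; rewrite addr_ge0 // sumr_ge0 // => l _; apply: mul_conjC_ge0.
Qed.

(** At the identity the finite sum is the integral of the constant 1, that is, the total mass of
    [P]. *)
Lemma chi_z1 : chi_z c z P (Ginf_of (1%g : wreath gT n)) = 1.
Proof.
transitivity (cintegral P (fun y => (fun=> 1 : R[i]) (vproj y n))).
  rewrite chi_z_sum mulr_sumr.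
  apply/esym; apply: etrans (@cintegral_level n (fun=> 1)) _; apply: eq_bigr => y _.
  by rewrite mulg1 mul1r ewens_class_weight.
have e r : Rintegral P setT (fun=> r) = r.
  rewrite /Rintegral integral_cst //.
  apply: etrans (congr1 (fun m => fine (r%:E * m)%E) (probability_setT P)) _.
  by rewrite mule1.
by rewrite /cintegral /= !e.
Qed.

(** Every normalized irreducible character is 1 at the identity, so the expansion there is the sum
    of the masses. *)
Lemma sum_multi_zmeasure : \sum_(L : multiyoung k n) multi_zmeasure c gamma z L = 1.
Proof.
rewrite -chi_z1 chi_z_expansion; apply: eq_bigr => L _.
rewrite repr_mx1 mxtrace1 divff ?mulr1 //.
by rewrite pnatr_eq0 -lt0n (irr_dim_gt0 (irr_labelled L)).
Qed.

End Main.

Theorem theorem8p1 (R : realType) (gT : finGroupType) (k : nat)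
    (c : 'I_k -> {set gT}) (gamma : 'I_k -> gT -> R[i]) (z : 'I_k -> R[i])
    (P : probability (vpermM gT) R)
    (hc : enum_classes c) (hgamma : enum_irr gamma)
    (hz : forall l, z l != 0)
    (hP : is_ewens c (fun l => Normc.normc (z l) ^+ 2) P)
    (n : nat) (hn : (0 < n)%N) (d : multiyoung k n -> nat)
    (rho : forall L, mx_representation R[i] [set: wreath gT n] (d L))
    (hrho : std_labelling c gamma rho) :
  [/\ forall L : multiyoung k n, 0 <= multi_zmeasure c gamma z L,
      \sum_(L : multiyoung k n) multi_zmeasure c gamma z L = 1
    & forall x : wreath gT n,
        chi_z c z P (Ginf_of x) =
        \sum_(L : multiyoung k n)
          multi_zmeasure c gamma z L * (\tr (rho L x) / (d L)%:R)].
Proof.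
split=> [L||x]; first exact: multi_zmeasure_ge0.
- exact: (sum_multi_zmeasure hc hgamma hz hP hrho).
- exact: (chi_z_expansion hc hgamma hz hP hrho).
Qed.
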